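(* Let $A$ be a projective plane of cardinality $\kappa\geq\aleph_1$ which admits a wellfounded HF-order. Then $A\cong F(A_0\cup X)$, where $A_0$ consists of five points $a_0,a_1,a_2,a_3,a_4$ together with a line $\ell=a_0\vee a_1$ incident with $a_0$ and $a_1$, and $X$ is a set of $\kappa$ points each incident with $\ell$ (and with nothing else), there being no other incidences in $A_0\cup X$.
   Context: Projective planes are taken as generalised $3$-gons: two-sorted structures (points, lines, incidence) whose incidence graph is bipartite with girth $6$ and diameter $3$; a partial plane is such a bipartite graph of girth at least $6$. For a partial plane $P$, its free completion $F(P)$ is $\bigcup_{i<\omega}P_i$ where $P_0=P$ and $P_{i+1}$ is obtained from $P_i$ by adding, for every pair $a,b\in P_i$ of the same sort with $d(a,b/P_i)=4$ or $d(a,b/P_i)=\infty$ (graph distance in $P_i$), a new element (of the other sort) incident exactly with $a$ and $b$. A wellfounded HF-order of a projective plane $A$ is a wellfounded linear order $<$ on $A$ such that every $c\in A$ is incident with at most two elements $d\in A$ with $d<c$.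
   Formalization: The projective plane A is additionally required to be thick (every point and every line is incident with at least three elements), since degenerate planes of girth 6 and diameter 3 with two-point lines are counterexamples. *)

(* Defs.v *)
From mathcomp Require Import all_boot.
From mathcomp Require Import all_classical.
From mathcomp Require Import zify.

Set Implicit Arguments.
Unset Strict Implicit.
Unset Printing Implicit Defensive.

Local Open Scope classical_set_scope.
Local Open Scope card_scope.

(* Graphs, given by an adjacency relation on an arbitrary vertex type. *)

Fixpoint walk (V : Type) (adj : V -> V -> Prop) (n : nat) (a b : V) : Prop :=
  if n is m.+1 then exists c, adj a c /\ walk adj m c b else a = b.

Definition at_distance (V : Type) (adj : V -> V -> Prop) (a b : V) (n : nat) :
    Prop :=
  walk adj n a b /\ forall m, m < n -> ~ walk adj m a b.

Definition at_infinite_distance (V : Type) (adj : V -> V -> Prop) (a b : V) :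
    Prop :=
  forall n, ~ walk adj n a b.

(* [ordS i] is [i + 1] modulo [n]. *)
Definition has_cycle (V : Type) (adj : V -> V -> Prop) (n : nat) : Prop :=
  2 < n /\
  exists c : 'I_n -> V, injective c /\ forall i, adj (c i) (c (ordS i)).

Definition girth_at_least (V : Type) (adj : V -> V -> Prop) (g : nat) : Prop :=
  forall n, has_cycle adj n -> g <= n.

Definition has_girth (V : Type) (adj : V -> V -> Prop) (g : nat) : Prop :=
  has_cycle adj g /\ girth_at_least adj g.

Definition has_diameter (V : Type) (adj : V -> V -> Prop) (d : nat) : Prop :=
  (forall a b, exists2 n, n <= d & at_distance adj a b n) /\
  exists a b, at_distance adj a b d.

Record incidence := Incidence {
  points : Type;
  lines : Type;
  incident : points -> lines -> Prop
}.

Definition elt (P : incidence) : Type := (points P + lines P)%type.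

(* The incidence graph; it is bipartite by construction. *)
Definition adjacent (P : incidence) (a b : elt P) : Prop :=
  match a, b with
  | inl p, inr l => incident p l
  | inr l, inl p => incident p l
  | _, _ => False
  end.

Definition partial_plane (P : incidence) : Prop :=
  girth_at_least (@adjacent P) 6.

Definition thick (P : incidence) : Prop :=
  forall a : elt P, `I_3 #<= [set b | adjacent a b].

(* Generalised polygons are required to be thick, i.e. to have all valencies at
   least 3.  Girth 6 and diameter 3 alone also allow degenerate planes, such as
   a line, its points, a point off it, and the lines joining that point to
   them. *)
Definition projective_plane (P : incidence) : Prop :=
  [/\ has_girth (@adjacent P) 6, has_diameter (@adjacent P) 3 & thick P].

Definition isomorphic (P Q : incidence) : Prop :=
  exists (f : points P -> points Q) (g : lines P -> lines Q),
    [/\ bijective f, bijective g &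
        forall p l, incident p l <-> incident (f p) (g l)].

Definition wellfounded_HF_order (P : incidence) (lt : elt P -> elt P -> Prop) :
    Prop :=
  [/\ forall a, ~ lt a a,
      forall a b c, lt a b -> lt b c -> lt a c,
      forall a b, [\/ lt a b, a = b | lt b a],
      well_founded lt &
      forall c, [set d | adjacent c d /\ lt d c] #<= `I_2].

(* Free completion *)

Definition unjoined (P : incidence) (a b : elt P) : Prop :=
  at_distance (@adjacent P) a b 4 \/ at_infinite_distance (@adjacent P) a b.

(* A new element is represented by the unordered pair of elements, as a two
   element set, that it is added for; distinct pairs give distinct elements. *)
Definition new_line (P : incidence) : Type :=
  {S : set (points P) |
    exists a b : points P,
      unjoined (inl a : elt P) (inl b) /\ S = [set a; b]}.

Definition new_point (P : incidence) : Type :=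
  {S : set (lines P) |
    exists a b : lines P,
      unjoined (inr a : elt P) (inr b) /\ S = [set a; b]}.

Definition free_step (P : incidence) : incidence :=
  {| points := (points P + new_point P)%type;
     lines := (lines P + new_line P)%type;
     incident := fun p l =>
       match p, l with
       | inl p, inl l => incident p l
       | inl p, inr s => sval s p
       | inr s, inl l => sval s l
       | inr _, inr _ => False
       end |}.

Definition stage (P : incidence) (n : nat) : incidence := iter n free_step P.

(* The union of the chain of stages, whose inclusions are the maps [inl], is
   represented as the disjoint union over [n] of the elements that first appear
   in stage [n]. *)
Definition born_point (P : incidence) (n : nat) : Type :=
  if n is m.+1 then new_point (stage P m) else points P.

Definition born_line (P : incidence) (n : nat) : Type :=
  if n is m.+1 then new_line (stage P m) else lines P.

Definition point_at_birth (P : incidence) (n : nat) :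
    born_point P n -> points (stage P n) :=
  match n with
  | 0 => fun p => p
  | m.+1 => fun p => inr p
  end.

Definition line_at_birth (P : incidence) (n : nat) :
    born_line P n -> lines (stage P n) :=
  match n with
  | 0 => fun l => l
  | m.+1 => fun l => inr l
  end.

(* [point_in_stage x n p]: the point [x] of the union lies in stage [n], where
   it is the point [p]. *)
Inductive point_in_stage (P : incidence) (x : {n : nat & born_point P n}) :
    forall n, points (stage P n) -> Prop :=
  | point_in_birth_stage : point_in_stage x (point_at_birth (projT2 x))
  | point_in_next_stage n (p : points (stage P n)) :
      point_in_stage x p ->
      point_in_stage x (inl p : points (stage P n.+1)).

Inductive line_in_stage (P : incidence) (y : {n : nat & born_line P n}) :
    forall n, lines (stage P n) -> Prop :=
  | line_in_birth_stage : line_in_stage y (line_at_birth (projT2 y))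
  | line_in_next_stage n (l : lines (stage P n)) :
      line_in_stage y l ->
      line_in_stage y (inl l : lines (stage P n.+1)).

Definition free_completion (P : incidence) : incidence :=
  {| points := {n : nat & born_point P n};
     lines := {n : nat & born_line P n};
     incident := fun x y =>
       exists (n : nat) (p : points (stage P n)) (l : lines (stage P n)),
         [/\ point_in_stage x p, line_in_stage y l & incident p l] |}.

(* Five points [inl i], the first two of them on the line [tt], together with
   the points [inr x], all of them on [tt]. *)
Definition A0_union (X : Type) : incidence :=
  {| points := ('I_5 + X)%type;
     lines := unit;
     incident := fun p _ => if p is inl i then i < 2 else True |}.

Lemma A0_union_partial_plane (X : Type) : partial_plane (A0_union X).
Proof.
move=> n [n_gt2 [c [c_inj c_adj]]].
have tri (a b d e : elt (A0_union X)) :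
    adjacent a b -> adjacent b d -> adjacent d e -> a = d \/ b = e.
  by case: a b d e => [a|[]] [b|[]] [d|[]] [e|[]] //=; by [left|right].
have ord2 i : i <> ordS (ordS i) :> 'I_n.
  case: i => i ltin /(congr1 val) /= i_eq; move: (i_eq).
  rewrite -addn1 modnDml addn1 => {}i_eq.
  case: (ltnP i.+2 n) i_eq => [lt2|ge2]; first by rewrite modn_small //; lia.
  have -> : i.+2 = n + (i.+2 - n) by rewrite subnKC.
  by rewrite modnDl modn_small; lia.
have n_gt0 : 0 < n by apply: leq_trans n_gt2.
set i := Ordinal n_gt0.
by case: (tri _ _ _ _ (c_adj i) (c_adj _) (c_adj _)) => /c_inj /ord2.
Qed.

(* Main.v *)
(* An HF-order orients each incidence from the later element to the earlier one;
   this orientation D is wellfounded with at most two arrows out of each element,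
   and only D matters.  An element with two out-arrows is the join (or meet) of
   its out-neighbours, so A is F(B) as soon as B spans a D-closed configuration
   containing every element with fewer out-arrows.

   B is reached by reversing arrows.  If N is D-closed, e lies outside N with at
   most one out-arrow, and m in N has the sort of e and misses the out-neighbours
   of e, then the element c joining e and m has out-neighbours exactly e and m.
   Reversing c -> e gives e one more out-arrow and leaves c with m only.  Once N
   contains a line l and a triangle off l, four simultaneous rounds of such
   reversals leave every element outside N with two out-arrows or as a point
   whose only out-neighbour is l.

   This is first done over a countable N, so that infinitely many points remain
   with l as only out-neighbour; joining these in pairs to two points of N and
   reversing arrows yields points without out-arrows.  Five of them, the line l'
   through two of them and the sides of the triangle formed by the other three
   form a closed set, over which the reversals are done a second time.  Since A
   is uncountable and generated by the five points and the points whose only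
   out-neighbour is l', there are as many of the latter as elements of A. *)
Require Import Defs.
From mathcomp Require Import all_boot.
From mathcomp Require Import all_classical.
From mathcomp Require Import zify.

Local Open Scope classical_set_scope.
Local Open Scope card_scope.

(** * Cardinals *)

Lemma chain2 {T} {F : set (set T)} {x y : T} : total_on F subset ->
  (\bigcup_(X in F) X) x -> (\bigcup_(X in F) X) y ->
  exists2 X, F X & X x /\ X y.
Proof.
move=> tot [X FX Xx] [Y FY Yy].
case: (tot _ _ FX FY) => sub; first by exists Y => //; split=> //; exact: sub.
by exists X => //; split=> //; exact: sub.
Qed.

(** A maximal partial injection from [A] to [B], given by its graph [G], is total or onto; otherwise
    a pair of unmatched elements could be added to it. *)
Lemma set_comparable {K : Type} (A B : set K) : exists f : K -> K,
  ((forall a, A a -> B (f a)) /\ {in A &, injective f}) \/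
  ((forall b, B b -> A (f b)) /\ {in B &, injective f}).
Proof.
pose P (G : set (K * K)) := [/\ forall a b, G (a, b) -> A a /\ B b,
  forall a b b', G (a, b) -> G (a, b') -> b = b' &
  forall a a' b, G (a, b) -> G (a', b) -> a = a'].
have [F FP tot|G [[GAB fun_G inj_G] G_max]] := @Zorn_bigcup _ P.
  split.
  - by move=> a b [X FX]; have [+ _ _] := FP _ FX; apply.
  - move=> a b b' /(chain2 tot) h /h[X FX []].
    by have [_ + _] := FP _ FX; apply.
  - move=> a a' b /(chain2 tot) h /h[X FX []].
    by have [_ _ +] := FP _ FX; apply.
have [[a [Aa Ga]]|nA] := pselect (exists a, A a /\ forall b, ~ G (a, b)).
  have [[b [Bb Gb]]|nB] := pselect (exists b, B b /\ forall a, ~ G (a, b)).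
    exfalso; apply: (G_max (G `|` [set (a, b)])).
      split; first by move=> ? ?; left.
      by move=> /(_ (a, b)) h; apply: (Ga b); apply: h; right.
    split.
    - by move=> x y [/GAB//|[-> ->]].
    - move=> x y y' [Gxy|[-> ->]] [Gxy'|] //; first exact: (fun_G x).
      + by case=> ? ?; subst; case: (Ga y).
      + by case: (Ga y').
      + by case.
    - move=> x x' y [Gxy|[-> ->]] [Gxy'|] //; first exact: (inj_G _ _ y).
      + by case=> ? ?; subst; case: (Gb x).
      + by case: (Gb x').
      + by case.
  have /choice[f fP] : forall b, exists a, B b -> G (a, b).
    move=> b; have [Bb|nBb] := pselect (B b); last by exists b.
    have [[a' h]|h] := pselect (exists a, G (a, b)); first by exists a'.
    by case: nB; exists b; split=> // a' h'; apply: h; exists a'.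
  exists f; right; split=> [b /fP /GAB[]//|b b'].
  by move=> /set_mem /fP h /set_mem /fP h' e; rewrite e in h; exact: fun_G h h'.
have /choice[f fP] : forall a, exists b, A a -> G (a, b).
  move=> b; have [Bb|nBb] := pselect (A b); last by exists b.
  have [[a' h]|h] := pselect (exists a, G (b, a)); first by exists a'.
  by case: nA; exists b; split=> // a' h'; apply: h; exists a'.
exists f; left; split=> [b /fP /GAB[]//|b b' /set_mem /fP h /set_mem /fP h' e].
by rewrite e in h; exact: inj_G h h'.
Qed.

(** * Pairings on infinite sets *)

Definition pairing {K : Type} (p : K -> K -> K) : Prop :=
  forall a b a' b', p a b = p a' b' -> a = a' /\ b = b'.

Section partial_pairing.
Context {K : Type}.
Implicit Type G : set (K * K * K).

(** The domain is read off the diagonal, so that [G] alone encodes a set with an injection of its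
    square into it, and Zorn's lemma applies to inclusion of graphs. *)
Definition carrier G : set K := [set a | exists c, G (a, a, c)].

Definition partial_pairing G : Prop :=
  [/\ forall a b c, G (a, b, c) -> [/\ carrier G a, carrier G b & carrier G c],
      forall a b, carrier G a -> carrier G b -> exists c, G (a, b, c),
      forall a b c c', G (a, b, c) -> G (a, b, c') -> c = c' &
      forall a b a' b' c, G (a, b, c) -> G (a', b', c) -> a = a' /\ b = b'].

Lemma partial_pairing_chain {F : set (set (K * K * K))} :
  F `<=` partial_pairing -> total_on F subset ->
  partial_pairing (\bigcup_(G in F) G).
Proof.
move=> FP tot; split.
- move=> a b c [G FG Gabc]; have [h _ _ _] := FP _ FG.
  by have [[x ?] [y ?] [z ?]] := h _ _ _ Gabc; split;
    [exists x|exists y|exists z]; exists G.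
- move=> a b [c Gc] [d Gd]; have [G FG [Gac Gbd]] := chain2 tot Gc Gd.
  have [_ h _ _] := FP _ FG.
  have [||z ?] := h a b; [by exists c|by exists d|by exists z; exists G].
- move=> a b c c' /(chain2 tot) h /h[G FG []].
  by have [_ _ + _] := FP _ FG; apply.
- move=> a b a' b' c /(chain2 tot) h /h[G FG []].
  by have [_ _ _ +] := FP _ FG; apply.
Qed.

(* With T := f @` S disjoint from S, the map u injects S `|` T into S, so that
   f (p (u a) (u b)), a value in T, is available for the new pairs (a, b). *)
Lemma partial_pairing_extend {G} {p : K -> K -> K} {s0 s1 : K} {f : K -> K} :
  partial_pairing G ->
  (forall a b, carrier G a -> carrier G b -> G (a, b, p a b)) ->
  carrier G s0 -> carrier G s1 -> s0 <> s1 ->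
  (forall a, carrier G a -> ~ carrier G (f a)) ->
  (forall a b, carrier G a -> carrier G b -> f a = f b -> a = b) ->
  exists2 G', G `<` G' & partial_pairing G'.
Proof.
set S := carrier G => -[g1 g2 g3 g4] pP Ss0 Ss1 s01 fS f_inj.
have p_S a b : S a -> S b -> S (p a b).
  by move=> Sa Sb; have [] := g1 _ _ _ (pP _ _ Sa Sb).
have p_inj a b a' b' : S a -> S b -> S a' -> S b' -> p a b = p a' b' ->
    a = a' /\ b = b'.
  move=> Sa Sb Sa' Sb' e; have := pP _ _ Sa Sb; rewrite e => h.
  exact: g4 h (pP _ _ Sa' Sb').
pose T := f @` S.
have /choice[u uP] : forall a, exists b, (S a -> b = p s0 a) /\
    (forall x, S x -> a = f x -> b = p s1 x).
  move=> a; have [Sa|nSa] := pselect (S a).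
    by exists (p s0 a); split=> // x Sx e; case: (fS _ Sx); rewrite -e.
  have [[x [Sx e]]|nx] := pselect (exists x, S x /\ a = f x).
    by exists (p s1 x); split=> // y Sy; rewrite e => /f_inj ->.
  by exists a; split=> // x Sx e; case: nx; exists x.
have uS a : S a \/ T a -> S (u a).
  have [h1 h2] := uP a.
  by move=> [Sa|[x Sx xa]]; [rewrite h1 //|rewrite (h2 x) //]; apply: p_S.
have u_inj a b : S a \/ T a -> S b \/ T b -> u a = u b -> a = b.
  have [h1 h2] := uP a; have [k1 k2] := uP b.
  move=> [Sa|[x Sx xa]] [Sb|[y Sy yb]].
  - by rewrite h1 // k1 // => /p_inj[].
  - by rewrite h1 // (k2 y) // => /p_inj[].
  - by rewrite (h2 x) // k1 // => /p_inj[] // /esym.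
  - by rewrite (h2 x) // (k2 y) // -xa -yb => /p_inj[] // _ ->.
pose U a := S a \/ T a.
pose G' : set (K * K * K) := fun t => G t \/
  [/\ U t.1.1, U t.1.2, ~ (S t.1.1 /\ S t.1.2) &
      t.2 = f (p (u t.1.1) (u t.1.2))].
have U_G' a : U a -> carrier G' a.
  move=> Ua; have [[c Gc]|nSa] := pselect (S a); first by exists c; left.
  exists (f (p (u a) (u a))); right; split=> //=; tauto.
have SU a : S a -> U a by left.
have G'_U a b c : G' (a, b, c) -> [/\ U a, U b & U c].
  move=> [/g1[*]|[/= Ua Ub _ ->]]; first by split; apply: SU.
  by split=> //; right; exists (p (u a) (u b)) => //; apply: p_S; apply: uS.
have S_f x : S x -> ~ S (f x) by move=> Sx; exact: fS.
exists G'.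
  split=> [t Gt|]; first by left.
  (* A diagonal triple at [f s0] in [G] would put [f s0] into [S], so this triple is new. *)
  move=> /(_ (f s0, f s0, f (p (u (f s0)) (u (f s0))))) h.
  apply: (fS _ Ss0); exists (f (p (u (f s0)) (u (f s0)))); apply: h; right.
  have Uf : U (f s0) by right; exists s0.
  by split=> //= -[/(S_f _ Ss0)].
split.
- by move=> a b c /G'_U[? ? ?]; split; apply: U_G'.
- move=> a b [c /G'_U[Ua _ _]] [d /G'_U[Ub _ _]].
  have [[Sa Sb]|n] := pselect (S a /\ S b).
    by have [c' h] := g2 a b Sa Sb; exists c'; left.
  by exists (f (p (u a) (u b))); right.
- move=> a b c c' [Gc|[/= Ua Ub n ->]] [Gc'|[/= Ua' Ub' n' ->]] //.
  + exact: g3 Gc Gc'.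
  + by case: n'; have [] := g1 _ _ _ Gc.
  + by case: n; have [] := g1 _ _ _ Gc'.
- move=> a b a' b' c [Gc|[/= Ua Ub n e]] [Gc'|[/= Ua' Ub' n' e']] //.
  + exact: g4 Gc Gc'.
  + have [_ _] := g1 _ _ _ Gc; rewrite e' => Sf.
    by case: (S_f _ _ Sf); apply: p_S; apply: uS.
  + have [_ _] := g1 _ _ _ Gc'; rewrite e => Sf.
    by case: (S_f _ _ Sf); apply: p_S; apply: uS.
  + move: e'; rewrite e => /f_inj h.
    have [|] := p_inj _ _ _ _ (uS _ Ua) (uS _ Ub) (uS _ Ua') (uS _ Ub').
      by apply: h; apply: p_S; apply: uS.
    by move=> /u_inj -> // /u_inj ->.
Qed.

End partial_pairing.

(* A maximal partial pairing containing one on a countable set has a carrier S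
   whose complement injects into S: otherwise it could be extended. *)
Lemma pairing_exists {K : Type} {e : nat -> K} :
  injective e -> exists p : K -> K -> K, pairing p.
Proof.
move=> e_inj.
pose G0 : set (K * K * K) :=
  [set t | exists i j : nat, t = (e i, e j, e (pickle (i, j)))].
have G0S a : carrier G0 a <-> exists i, a = e i.
  split=> [[c [i [j [-> _ _]]]]|[i ->]]; first by exists i.
  by exists (e (pickle (i, i))); exists i, i.
have G0P : partial_pairing G0.
  split.
  - by move=> a b c [i [j [-> -> ->]]]; split; apply/G0S; eexists.
  - move=> a b /G0S[i ->] /G0S[j ->].
    by exists (e (pickle (i, j))); exists i, j.
  - by move=> a b c c' [i [j [-> -> ->]]] [i' [j' [/e_inj <- /e_inj <- ->]]].
  - move=> a b a' b' c [i [j [-> -> ->]]] [i' [j' [-> -> /e_inj]]].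
    by move=> /(pcan_inj (@pickleK _)) [-> ->].
(* The empty chain has union [set0], so only a nonempty [G] can be asked to contain [G0]. *)
pose P G := partial_pairing G /\ (G !=set0 -> G0 `<=` G).
have [F FP tot|G [[GP G0G] G_max]] := @Zorn_bigcup _ P.
  split; first by apply: partial_pairing_chain => // G /FP[].
  move=> [t [G FG Gt]] x G0x; exists G => //.
  by have [_ h] := FP _ FG; apply: h G0x; exists t.
have {}G0G : G0 `<=` G.
  apply: G0G; apply: contrapT => nG0.
  have G_0 : G = set0 by apply/seteqP; split=> // t Gt; apply: nG0; exists t.
  apply: (G_max G0); last by split=> // _ t.
  rewrite G_0; split=> // /(_ (e 0, e 0, e (pickle (0, 0)))) h.
  by apply: h; exists 0, 0.
have Se i : carrier G (e i).
  by exists (e (pickle (i, i))); apply: G0G; exists i, i.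
have [g1 g2 g3 g4] := GP.
have /choice[p0 p0P] : forall ab, exists c,
    carrier G ab.1 -> carrier G ab.2 -> G (ab.1, ab.2, c).
  move=> ab; have [h|n] := pselect (carrier G ab.1 /\ carrier G ab.2).
    by have [c Gc] := g2 _ _ h.1 h.2; exists c.
  by exists ab.1 => h1 h2; case: n.
pose p a b := p0 (a, b).
have pP a b : carrier G a -> carrier G b -> G (a, b, p a b).
  exact: (p0P (a, b)).
have p_S a b : carrier G a -> carrier G b -> carrier G (p a b).
  by move=> Sa Sb; have [] := g1 _ _ _ (pP _ _ Sa Sb).
have p_inj a b a' b' : carrier G a -> carrier G b -> carrier G a' ->
    carrier G b' -> p a b = p a' b' -> a = a' /\ b = b'.
  move=> Sa Sb Sa' Sb' eq_p; have := pP _ _ Sa Sb; rewrite eq_p => h.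
  exact: g4 h (pP _ _ Sa' Sb').
have e01 : e 0 <> e 1 by move=> /e_inj.
have [f [] [fS f_inj]] := set_comparable (carrier G) (~` carrier G).
  have [|G' GG' G'P] := partial_pairing_extend GP pP (Se 0) (Se 1) e01 fS.
    by move=> a b Sa Sb; apply: f_inj; apply/mem_set.
  case: (G_max G') => //; split=> // _ t /G0G; exact: GG'.1.
(* [j] injects all of [K] into the carrier: [e 0] marks the elements of the carrier, [e 1] the
   others, which [f] brings in. *)
have /choice[j jP] : forall a, exists b, (carrier G a -> b = p (e 0) a) /\
    (~ carrier G a -> b = p (e 1) (f a)).
  move=> a; have [Sa|nSa] := pselect (carrier G a).
    by exists (p (e 0) a).
  by exists (p (e 1) (f a)).
have jS a : carrier G (j a).
  have [h1 h2] := jP a; have [Sa|nSa] := pselect (carrier G a).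
    by rewrite h1 //; apply: p_S.
  by rewrite h2 //; apply: p_S => //; apply: fS.
have j_inj : injective j.
  move=> a b; have [h1 h2] := jP a; have [k1 k2] := jP b.
  have [Sa|nSa] := pselect (carrier G a);
    have [Sb|nSb] := pselect (carrier G b).
  - by rewrite h1 // k1 // => /p_inj[].
  - by rewrite h1 // k2 // => /p_inj[] //; exact: fS.
  - by rewrite h2 // k1 // => /p_inj[] //; [exact: fS|move/esym].
  - rewrite h2 // k2 // => /p_inj[] //; try exact: fS.
    by move=> _; apply: f_inj; apply/mem_set.
exists (fun a b => p (j a) (j b)) => a b a' b' /p_inj[] //.
by move=> /j_inj -> /j_inj ->.
Qed.

(** * Orientations *)

(** Points and lines share one vertex type with a Boolean [sort], so that each statement below also
    covers its dual. *)
Record plane_graph {V : Type} (adj : V -> V -> Prop) (sort : V -> bool) :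
    Prop := PlaneGraph {
  adj_sym : forall x y, adj x y -> adj y x;
  adj_sort : forall x y, adj x y -> sort x = ~~ sort y;
  join_exists : forall x y, x <> y -> sort x = sort y ->
    exists z, adj z x /\ adj z y;
  join_unique : forall x y z w, x <> y -> adj z x -> adj z y -> adj w x ->
    adj w y -> z = w
}.
Arguments adj_sym {V adj sort} _ {x y}.
Arguments adj_sort {V adj sort} _ {x y}.
Arguments join_exists {V adj sort} _ {x y}.
Arguments join_unique {V adj sort} _ {x y z w}.

(** [D x y] is an arrow from [x] to [y], and [out_wf] forbids infinite paths of arrows. It also
    prevents an edge from carrying arrows in both directions. *)
Record orientation {V : Type} (adj D : V -> V -> Prop) : Prop := Orientation {
  out_adj : forall x y, D x y -> adj x y;
  adj_out : forall x y, adj x y -> D x y \/ D y x;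
  out_le2 : forall x y1 y2 y3, D x y1 -> D x y2 -> D x y3 ->
    [\/ y1 = y2, y1 = y3 | y2 = y3];
  out_wf : well_founded (fun y x => D x y)
}.
Arguments out_adj {V adj D} _ {x y}.
Arguments adj_out {V adj D} _ {x y}.
Arguments out_le2 {V adj D} _ {x y1 y2 y3}.
Arguments out_wf {V adj D} _.

Section orientations.
Context {V : Type} {adj : V -> V -> Prop} {sort : V -> bool}.
Hypothesis pg : plane_graph adj sort.
Implicit Types (D : V -> V -> Prop) (N E : set V).

Definition out_closed D N : Prop := forall x y, N x -> D x y -> N y.

Definition two_out D (x : V) : Prop := exists y z, [/\ y <> z, D x y & D x z].

Definition le1_out D (x : V) : Prop := forall y z, D x y -> D x z -> y = z.

Definition only_out D (x a : V) : Prop := forall y, D x y <-> y = a.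

Lemma not_two_outP D x : ~ two_out D x <-> le1_out D x.
Proof.
split=> [n y z Dy Dz|le1 [y [z [yz Dy Dz]]]]; last exact/yz/le1.
by apply: contrapT => yz; apply: n; exists y, z.
Qed.

Lemma only_out_le1 {D x a} : only_out D x a -> le1_out D x.
Proof. by move=> xa y z /xa -> /xa. Qed.

Lemma out_asym {D x y} : orientation adj D -> D x y -> ~ D y x.
Proof.
move=> oD; move: x y; apply: (well_founded_ind (out_wf oD)) => x IH y Dxy Dyx.
exact: (IH _ Dxy _ Dyx Dxy).
Qed.

Lemma adj_closed {D N x y} : orientation adj D -> out_closed D N ->
  ~ N x -> N y -> adj x y -> D x y.
Proof. by move=> oD cN Nx Ny /(adj_out oD)[//|/(cN _ _ Ny)]. Qed.

(** The arrows from [c e] to [e], for [e] in [E], are turned round and the rest of [D] is kept. *)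
Definition reverse D E (c : V -> V) (x y : V) : Prop :=
  E x /\ y = c x \/ D x y /\ ~ (E y /\ x = c y).

(** An element of [E] has at most one arrow and gains one. For wellfoundedness, a path that takes a
    new arrow to [c e] can continue only into [N], and no arrow out of an element of [N] is
    added. *)
Lemma reverse_orientation {D N E c} : orientation adj D -> out_closed D N ->
    (forall e, E e -> [/\ ~ N e, D (c e) e, ~ E (c e) & le1_out D e]) ->
    (forall e y, E e -> D (c e) y -> y = e \/ N y) ->
    (forall e e', E e -> E e' -> c e = c e' -> e = e') ->
  orientation adj (reverse D E c).
Proof.
move=> oD cN EP cEN c_inj; split.
- move=> x y [[Ex ->]|[/(out_adj oD)//]].
  by have [_ h _ _] := EP _ Ex; apply: (adj_sym pg); exact: (out_adj oD h).
- have rev x y : D x y -> reverse D E c x y \/ reverse D E c y x.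
    move=> Dxy; have [[Ey xy]|n] := pselect (E y /\ x = c y).
      by right; left.
    by left; right.
  by move=> x y /(adj_out oD)[/rev//|/rev[]]; tauto.
- move=> x y1 y2 y3.
  have [Ex|nEx] := pselect (E x).
    have [_ _ _ le1] := EP _ Ex.
    have eqD y z : D x y -> D x z -> y = z by apply: le1.
    move=> [[_ ->]|[D1 _]] [[_ ->]|[D2 _]] [[_ ->]|[D3 _]];
      by [apply: Or31|apply: Or32|apply: Or33|apply: Or33; apply: eqD
         |apply: Or32; apply: eqD|apply: Or31; apply: eqD].
  move=> [[//]|[D1 _]] [[//]|[D2 _]] [[//]|[D3 _]].
  exact: (out_le2 oD D1 D2 D3).
have accN x : N x -> Acc (fun y x => reverse D E c x y) x.
  elim/(well_founded_ind (out_wf oD)): x => x IH Nx; split=> y.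
  move=> [[Ex _]|[Dxy _]]; first by have [] := EP _ Ex.
  by apply: IH => //; apply: cN Nx Dxy.
suff acc x : Acc (fun y x => reverse D E c x y) x /\
    (E x -> Acc (fun y x => reverse D E c x y) (c x)).
  by move=> x; exact: (acc x).1.
elim/(well_founded_ind (out_wf oD)): x => x IH.
have acc_c : E x -> Acc (fun y x => reverse D E c x y) (c x).
  move=> Ex; split=> y [[Ecx _]|[Dcxy n]]; first by have [] := EP _ Ex.
  have [yx|Ny] := cEN _ _ Ex Dcxy; last exact: accN.
  by case: n; rewrite yx.
split; last exact: acc_c.
split=> y [[Ex ->]|[Dxy _]]; first exact: acc_c.
exact: (IH y Dxy).1.
Qed.

Lemma reverse_closed {D N E c} : out_closed D N ->
    (forall e, E e -> ~ N e) ->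
  forall x, N x -> forall y, reverse D E c x y <-> D x y.
Proof.
move=> cN EN x Nx y; split=> [[[/EN//]|[]]//|Dxy].
by right; split=> // -[/EN + _]; apply; exact: cN Dxy.
Qed.

Lemma same_closed {D D' N} : out_closed D N ->
  (forall x, N x -> forall y, D' x y <-> D x y) -> out_closed D' N.
Proof. by move=> cN DD' x y Nx /(DD' _ Nx); exact: cN. Qed.

(** An arrow from [e] to [c] would make [c] an out-neighbour of [e] adjacent to [m], so the edge
    points from [c] to [e]. Hence [c] is outside [N], and its edge to [m] points into [N]. These two
    arrows exhaust the bound. *)
Lemma join_out {D N e m c} : orientation adj D -> out_closed D N ->
    ~ N e -> N m -> (forall y, D e y -> ~ adj y m) ->
    adj c e -> adj c m ->
  [/\ ~ N c, D c e, D c m & forall y, D c y -> y = e \/ y = m].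
Proof.
move=> oD cN nNe Nm em ce cm.
have Dce : D c e.
  by have [//|/em h] := adj_out oD ce.
have nNc : ~ N c by move=> Nc; apply: nNe; exact: (cN _ _ Nc Dce).
have Dcm : D c m by exact: (adj_closed oD cN).
split=> // y Dcy; have [em'|<-|<-] := out_le2 oD Dce Dcm Dcy; [|by left|by right].
by case: nNe; rewrite em'.
Qed.

(** By [join_out] the join [c e] has exactly two out-neighbours, [e] outside [N] and [m e] inside.
    So [c] is injective, and [c e] is not in [E], whose members have at most one arrow. All arrows
    from [c e] to [e] can therefore be reversed at once. *)
Lemma join_pass {D N E m} : orientation adj D -> out_closed D N ->
    (forall e, E e -> [/\ ~ N e, N (m e), sort (m e) = sort e &
       forall y, D e y -> ~ adj y (m e)]) ->
    (forall e, E e -> le1_out D e) ->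
  exists D' (c : V -> V), [/\ orientation adj D',
    forall x, N x -> forall y, D' x y <-> D x y,
    forall e, E e -> [/\ ~ N (c e), adj (c e) e, only_out D' (c e) (m e),
       ~ D e (c e) & forall y, D' e y <-> D e y \/ y = c e],
    forall e e', E e -> E e' -> c e = c e' -> e = e' &
    forall x, ~ E x -> (forall e, E e -> x <> c e) ->
      forall y, D' x y <-> D x y].
Proof.
move=> oD cN EP le1.
have /choice[c cP] : forall e, exists c, E e -> adj c e /\ adj c (m e).
  move=> e; have [Ee|nEe] := pselect (E e); last by exists e.
  have [nNe Nm me _] := EP _ Ee.
  have [|c cP] := join_exists pg _ (esym me); last by exists c.
  by move=> em; apply: nNe; rewrite em.
have {}cP e : E e -> [/\ ~ N (c e), D (c e) e, D (c e) (m e) &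
    forall y, D (c e) y -> y = e \/ y = m e].
  by move=> Ee; have [? ? _ ?] := EP _ Ee; have [? ?] := cP _ Ee; exact: join_out.
have c_inj e e' : E e -> E e' -> c e = c e' -> e = e'.
  move=> Ee Ee' cee'; have [_ _ _ h] := cP _ Ee'; have [_ + _ _] := cP _ Ee.
  have [nNe _ _ _] := EP _ Ee; have [_ Nm _ _] := EP _ Ee'.
  by rewrite cee' => /h[//|em]; case: nNe; rewrite em.
have nEc e e' : E e -> E e' -> e <> c e'.
  move=> Ee Ee' ee'; have [_ h1 h2 _] := cP _ Ee'.
  have [nNe' Nm _ _] := EP _ Ee'; apply: nNe'.
  by rewrite -ee' in h1 h2; rewrite (le1 _ Ee _ _ h1 h2).
have oD' : orientation adj (reverse D E c).
  apply: (reverse_orientation oD cN) => // e.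
    move=> Ee; have [? _ _ _] := EP _ Ee; have [_ ? _ _] := cP _ Ee; split=> //.
      by move=> Ece; exact: (nEc _ _ Ece Ee erefl).
    exact: le1.
  move=> y Ee; have [_ _ _ h] := cP _ Ee; have [_ Nm _ _] := EP _ Ee.
  by move=> /h[->|->]; tauto.
exists (reverse D E c), c; split=> //.
- by apply: reverse_closed => // e /EP[].
- move=> e Ee; have [nNc Dce Dcm cout] := cP _ Ee; have [nNe Nm _ _] := EP _ Ee.
  split=> //; first exact: out_adj Dce.
  + move=> y; split=> [[[Ece _]|[/cout[->|//] []]]|->] //.
      by case: (nEc _ _ Ece Ee).
    by right; split=> // -[/EP[]].
  + exact: out_asym oD Dce.
  + move=> y; split=> [[[_ ->]|[]]|[Dey|->]]; [by right|by left| |by left].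
    by right; split=> // -[Ey ey]; case: (nEc _ _ Ee Ey).
- move=> x nEx xc y; split=> [[[]|[]]//|Dxy]; right; split=> // -[Ey].
  exact: xc.
Qed.

(** A round of reversals is described by its effect on each element outside [N], so that rounds can
    be chained. [Q] records what is known of the target [m] chosen for [e], to which the join keeps
    its last arrow. *)
Lemma pass {D N E} (Q : V -> V -> Prop) : orientation adj D -> out_closed D N ->
    (forall e, E e -> [/\ ~ N e, le1_out D e & exists m, [/\ N m,
       sort m = sort e, forall y, D e y -> ~ adj y m & Q e m]]) ->
  exists D', [/\ orientation adj D',
    forall x, N x -> forall y, D' x y <-> D x y &
    forall x, ~ N x -> [\/ E x /\ exists w, ~ D x w /\
        forall y, D' x y <-> D x y \/ y = w,
      exists e m, [/\ E e, sort x = ~~ sort e, Q e m & only_out D' x m] |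
      ~ E x /\ forall y, D' x y <-> D x y]].
Proof.
move=> oD cN EP.
have /choice[m mP] : forall e, exists m, E e -> [/\ N m,
       sort m = sort e, forall y, D e y -> ~ adj y m & Q e m].
  move=> e; have [Ee|nEe] := pselect (E e); last by exists e.
  by have [_ _ [m ?]] := EP _ Ee; exists m.
have [||D' [c [oD' DD' D'E c_inj D'n]]] := @join_pass D N E m oD cN.
- by move=> e Ee; have [? _ _] := EP _ Ee; have [] := mP _ Ee.
- by move=> e /EP[].
exists D'; split=> // x nNx.
have [Ex|nEx] := pselect (E x).
  by apply: Or31; split=> //; have [_ _ _ h1 h2] := D'E _ Ex; exists (c x).
have [[e [Ee ->]]|nc] := pselect (exists e, E e /\ x = c e).
  apply: Or32; exists e, (m e); have [_ h1 h2 _ _] := D'E _ Ee.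
  have [_ _ _ Qe] := mP _ Ee; split=> //; exact: (adj_sort pg).
apply: Or33; split=> //; apply: D'n => // e Ee xc; apply: nc; by exists e.
Qed.

Lemma two_out_same {D D' x} : (forall y, D' x y <-> D x y) ->
  two_out D x -> two_out D' x.
Proof. by move=> h [y [z [yz /h Dy /h Dz]]]; exists y, z. Qed.

Lemma only_out_same {D D' x a} : (forall y, D' x y <-> D x y) ->
  only_out D x a -> only_out D' x a.
Proof. by move=> h xa y; rewrite h. Qed.

Lemma two_out_add {D D' x w} y : ~ D x w ->
  (forall y, D' x y <-> D x y \/ y = w) -> D x y -> two_out D' x.
Proof.
move=> nw h Dy; exists y, w; split; last by apply/h; right.
  by move=> yw; apply: nw; rewrite -yw.
by apply/h; left.
Qed.

(** Call the elements of the sort of [l] lines, the others points. Each round gives the elements of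
    one defective kind a further arrow, and the joins that lose one are left to the later rounds;
    those of the last round keep the permitted arrow to [l]. *)
Lemma normalize {D N l} : orientation adj D -> out_closed D N -> N l ->
    (forall x, sort x = sort l -> exists p, [/\ N p, sort p = ~~ sort l,
       ~ adj l p & ~ adj x p]) ->
    (forall x, sort x = ~~ sort l -> exists m, [/\ N m, sort m = sort l &
       ~ adj x m]) ->
  exists D', [/\ orientation adj D',
    forall x, N x -> forall y, D' x y <-> D x y &
    forall x, ~ N x -> two_out D' x \/ only_out D' x l].
Proof.
move=> oD cN Nl point_off line_off.
have [p0 [Np0 sp0 _ _]] := point_off l erefl.
(* Round 1: elements without arrows gain one, and their joins keep one. *)
have [D0 [oD0 DD0 D0P]] : exists D', [/\ orientation adj D',
    forall x, N x -> forall y, D' x y <-> D x y &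
    forall x, ~ N x -> two_out D' x \/ exists a, only_out D' x a].
  have [|D' [oD' DD' D'P]] := @pass D N
    [set x | ~ N x /\ forall y, ~ D x y] (fun _ _ => True) oD cN.
    move=> e [nNe De]; split=> // [y z /De//|].
    have [se|se] := eqVneq (sort e) (sort l).
      by exists l; split=> // y /De.
    exists p0; split=> // [|y /De//].
    by rewrite sp0; case: (sort e) (sort l) se => [] [].
  exists D'; split=> // x nNx.
  case: (D'P _ nNx) => [[[_ xe] [w [_ h]]]|[e [m [_ _ _ h]]]|[nE h]].
  - right; exists w => y; rewrite h; split; last by right.
    by case=> // /xe.
  - by right; exists m.
  - have [two|n] := pselect (two_out D x); first by left; apply: (two_out_same h).
    have [[y Dy]|ny] := pselect (exists y, D x y).
      right; exists y => z; rewrite h; split=> [Dz|-> //].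
      by move/not_two_outP: n; apply.
    by case: nE; split=> // y Dy; apply: ny; exists y.
have cN0 := same_closed cN DD0.
(* Round 2: lines with one arrow gain a second. The joins are points, so outside [N] only points are
   left with a single arrow. *)
have [D1 [oD1 DD1 D1P]] : exists D', [/\ orientation adj D',
    forall x, N x -> forall y, D' x y <-> D x y &
    forall x, ~ N x -> two_out D' x \/
      sort x = ~~ sort l /\ exists a, only_out D' x a].
  have [|D' [oD' DD' D'P]] := @pass D0 N [set x | [/\ ~ N x,
      sort x = sort l & exists a, only_out D0 x a]] (fun _ _ => True) oD0 cN0.
    move=> e [nNe se [a ea]]; split=> //; first exact: only_out_le1 ea.
    have sa : sort a = ~~ sort l.
      by rewrite -se (adj_sort pg (out_adj oD0 (proj2 (ea a) erefl))) negbK.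
    have [m [Nm sm am]] := line_off a sa.
    exists m; split=> //; first by rewrite sm.
    by move=> y /ea ->.
  exists D'; split=> // [x Nx y|x nNx]; first by rewrite DD' // DD0.
  case: (D'P _ nNx) =>
    [[[_ _ [a xa]] [w [nw h]]]|[e [m [[_ se _] sx _ h]]]|[nE h]].
  - by left; apply: (two_out_add a nw h); apply/xa.
  - by right; split; [rewrite sx se|exists m].
  - have [two|[a xa]] := D0P _ nNx; first by left; apply: (two_out_same h).
    have [sx|sx] := eqVneq (sort x) (sort l).
      by case: nE; split=> //; exists a.
    right; split; first by case: (sort x) (sort l) sx => [] [].
    by exists a; apply: (only_out_same h).
have cN1 := same_closed cN DD1.
(* Round 3: points whose only arrow misses [l] gain a second. The joins are lines that keep one
   arrow, to a point [p] off [l]. *)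
have [D2 [oD2 DD2 D2P]] : exists D', [/\ orientation adj D',
    forall x, N x -> forall y, D' x y <-> D x y &
    forall x, ~ N x -> [\/ two_out D' x, only_out D' x l |
      sort x = sort l /\ exists2 p, ~ adj l p & only_out D' x p]].
  have [|D' [oD' DD' D'P]] := @pass D1 N [set x | [/\ ~ N x,
      sort x = ~~ sort l & exists2 a, a <> l & only_out D1 x a]]
      (fun _ p => ~ adj l p) oD1 cN1.
    move=> e [nNe se [a al ea]]; split=> //; first exact: only_out_le1 ea.
    have sa : sort a = sort l.
      by rewrite -[sort a]negbK -(adj_sort pg (out_adj oD1 (proj2 (ea a) erefl)))
        se negbK.
    have [p [Np sp lp ap]] := point_off a sa.
    exists p; split=> //; first by rewrite sp.
    by move=> y /ea ->.
  exists D'; split=> // [x Nx y|x nNx]; first by rewrite DD' // DD1.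
  case: (D'P _ nNx) =>
    [[[_ _ [a _ xa]] [w [nw h]]]|[e [m [[_ se _] sx lm h]]]|[nE h]].
  - by apply: Or31; apply: (two_out_add a nw h); apply/xa.
  - by apply: Or33; split; [rewrite sx se negbK|exists m].
  - have [two|[sx [a xa]]] := D1P _ nNx.
      by apply: Or31; apply: (two_out_same h).
    have [al|al] := pselect (a = l).
      by apply: Or32; rewrite -al; apply: (only_out_same h).
    by case: nE; split=> //; exists a.
have cN2 := same_closed cN DD2.
(* Round 4: these lines are met with [l] itself, which is allowed because [p] is off [l]; the meets
   keep only their arrow to [l]. *)
have [|D' [oD' DD' D'P]] := @pass D2 N [set x | [/\ ~ N x,
    sort x = sort l & exists2 p, ~ adj l p & only_out D2 x p]]
    (fun _ m => m = l) oD2 cN2.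
  move=> e [nNe se [p lp ep]]; split=> //; first exact: only_out_le1 ep.
  by exists l; split=> // y /ep -> /(adj_sym pg).
exists D'; split=> // [x Nx y|x nNx]; first by rewrite DD' // DD2.
case: (D'P _ nNx) => [[[_ _ [a _ xa]] [w [nw h]]]|[e [m [_ _ -> h]]]|[nE h]].
- by left; apply: (two_out_add a nw h); apply/xa.
- by right.
- case: (D2P _ nNx) => [two|xl|[sx [p lp xp]]].
  + by left; apply: (two_out_same h).
  + by right; apply: (only_out_same h).
  + by case: nE; split=> //; exists p.
Qed.

End orientations.

(** * Generation *)

(** Terms built from generators in [L] by a formal join. *)
Inductive tree (L : Type) : Type := Leaf of L | Node of tree L & tree L.
Arguments Leaf {L} _.
Arguments Node {L} _ _.

(** The tags [k0] and [k1] separate leaves from nodes. *)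
Fixpoint tree_code {K L : Type} (p : K -> K -> K) (k0 k1 : K) (i : L -> K)
    (t : tree L) : K :=
  match t with
  | Leaf k => p k0 (i k)
  | Node t u => p k1 (p (tree_code p k0 k1 i t) (tree_code p k0 k1 i u))
  end.

Lemma tree_code_inj {K L : Type} {p : K -> K -> K} {k0 k1 : K} {i : L -> K} :
  pairing p -> k0 <> k1 -> injective i -> injective (tree_code p k0 k1 i).
Proof.
move=> p_inj k01 i_inj; elim=> [k|t IHt u IHu] [k'|t' u'] /= /p_inj[].
- by move=> _ /i_inj ->.
- by move=> /k01.
- by move=> /esym /k01.
- by move=> _ /p_inj[/IHt -> /IHu ->].
Qed.

Fixpoint tree_eval {V L : Type} (s : L -> V) (J : V * V -> V) (t : tree L) : V :=
  match t with
  | Leaf k => s k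
  | Node t u => J (tree_eval s J t, tree_eval s J u)
  end.

Lemma pickle_pairing : pairing (fun a b : nat => pickle (a, b)).
Proof. by move=> a b a' b' /(pcan_inj (@pickleK _))[-> ->]. Qed.

Lemma card_le_inj {T U : Type} {A : set T} {B : set U} : A #<= B ->
  exists f : A -> B, injective f.
Proof. by move=> /card_leP[f]; exists f; exact: injT. Qed.

Lemma infinite_sequence {T : Type} {A : set T} : infinite_set A ->
  exists2 e : nat -> T, injective e & forall n, A (e n).
Proof.
move=> /infiniteP /card_le_inj[f f_inj].
exists (fun n => set_val (f (to_setT n))) => [m n /val_inj /f_inj|n].
  by move=> /(congr1 set_val).
exact: (set_valP (f (to_setT n))).
Qed.

Section generation.
Context {V : Type} {adj : V -> V -> Prop} {sort : V -> bool}.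
Hypothesis pg : plane_graph adj sort.
Implicit Types (D : V -> V -> Prop) (N E : set V).

(** An element with two arrows is the join of its out-neighbours, so induction along [D] writes
    every element as a term over the generators. [J] is made total by an arbitrary value where no
    join exists. *)
Lemma generated {D L} {s : L -> V} : orientation adj D ->
    (forall x, ~ two_out D x -> exists k, s k = x) ->
  exists J, forall x, exists t, tree_eval s J t = x.
Proof.
move=> oD sP.
have /choice[J JP] : forall yz : V * V, exists w, forall x, yz.1 <> yz.2 ->
    adj x yz.1 -> adj x yz.2 -> w = x.
  move=> [y z] /=.
  have [[w [wy wz]]|n] := pselect (exists w, adj w y /\ adj w z).
    by exists w => x yz xy xz; exact: (join_unique pg yz).
  by exists y => x _ xy xz; case: n; exists x.
exists J; apply: (well_founded_ind (out_wf oD)) => x IH.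
have [[y [z [yz Dy Dz]]]|/sP[k <-]] := pselect (two_out D x); last first.
  by exists (Leaf k).
have [[t ty] [u uz]] := (IH y Dy, IH z Dz).
exists (Node t u); rewrite /= ty uz.
by apply: JP => //; exact: (out_adj oD).
Qed.

(** A term chosen for each element determines it by evaluation, and terms inject into [K] by
    [tree_code]. *)
Lemma generated_card {D K L} {s : L -> V} {i : L -> K} {p : K -> K -> K}
    (k0 k1 : K) : orientation adj D ->
    (forall x, ~ two_out D x -> exists k, s k = x) ->
    injective i -> pairing p -> k0 <> k1 ->
  exists f : V -> K, injective f.
Proof.
move=> oD sP i_inj p_inj k01; have [J JP] := generated oD sP.
have [f fP] := choice JP.
exists (tree_code p k0 k1 i \o f); apply: inj_comp.
  exact: tree_code_inj.
by apply: (can_inj (g := tree_eval s J)).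
Qed.

(** With [B] finite, the terms would have countably many generators and [V] would be countable. *)
Lemma free_infinite {D} {C : nat -> V} {B : set V} : orientation adj D ->
    ~ countable [set: V] ->
    (forall x, ~ two_out D x -> (exists n, C n = x) \/ B x) ->
  infinite_set B.
Proof.
move=> oD V_unc CB /finite_set_countable /countable_injP[i i_inj].
have /choice[s sP] : forall n, exists x, forall y, B y -> i y = n -> x = y.
  move=> n; have [[x [Bx xn]]|h] := pselect (exists x, B x /\ i x = n).
    by exists x => y By yn; apply: i_inj; rewrite ?inE ?yn.
  by exists (C 0) => y By yn; case: h; exists y.
pose S (k : nat + nat) := match k with inl n => C n | inr n => s n end.
have [|||f f_inj] :=
  @generated_card D nat _ S pickle (fun a b => pickle (a, b)) 0 1 oD _ _
    pickle_pairing.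
- move=> x /CB[[n <-]|Bx]; first by exists (inl n).
  by exists (inr (i x)); apply: sP.
- exact: (pcan_inj (@pickleK _)).
- by [].
- by apply: V_unc; apply/countable_injP; exists f => ? ? _ _ /f_inj.
Qed.

(** An infinite [B] has a pairing, by which the terms over [B] and countably many further generators
    inject into [B]. *)
Lemma free_card {D} {C : nat -> V} {B : set V} : orientation adj D ->
    infinite_set B ->
    (forall x, ~ two_out D x -> (exists n, C n = x) \/ B x) ->
  exists2 f : V -> V, injective f & forall x, B (f x).
Proof.
move=> oD B_inf CB; have [e0 e0_inj e0B] := infinite_sequence B_inf.
pose K := {x : V | B x}.
pose e n : K := exist _ (e0 n) (e0B n).
have e_inj : injective e by move=> m n /(congr1 sval) /e0_inj.
have [p p_inj] := pairing_exists e_inj.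
have e01 : e 0 <> e 1 by move=> /e_inj.
pose s (k : nat + K) := match k with inl n => C n | inr x => sval x end.
pose i (k : nat + K) :=
  match k with inl n => p (e 0) (e n) | inr x => p (e 1) x end.
have [| |f f_inj] := @generated_card D K _ s i p (e 0) (e 1) oD _ _ p_inj e01.
- move=> x /CB[[n <-]|Bx]; first by exists (inl n).
  by exists (inr (exist _ x Bx)).
- move=> [m|x] [n|y] /= /p_inj[].
  + by move=> _ /e_inj ->.
  + by move=> /e01.
  + by move=> /esym /e01.
  + by move=> _ ->.
- exists (fun x => sval (f x)) => [x y|x]; last exact: svalP.
  by move=> /eq_sig_hprop h; apply: f_inj; apply: h => z; exact: Prop_irrelevance.
Qed.

(** The closure consists of the ends of finite paths of arrows from the [q n]. A path is coded by
    its start and a list of Booleans choosing between at most two arrows; where there is no arrow it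
    stays in place. *)
Lemma countable_out_closed {D} (q : nat -> V) : orientation adj D ->
  exists2 C : nat -> V, out_closed D (range C) & forall n, range C (q n).
Proof.
move=> oD.
have /choice[d dP] : forall x, exists yz : V * V, forall w, D x w ->
    w = yz.1 \/ w = yz.2.
  move=> x; have [[y [z [yz Dy Dz]]]|n] := pselect (two_out D x).
    exists (y, z) => w Dw; have [//|->|->] := out_le2 oD Dy Dz Dw.
      by left.
    by right.
  move/not_two_outP: n => n; have [[y Dy]|ny] := pselect (exists y, D x y).
    by exists (y, y) => w Dw; left; exact: n.
  by exists (x, x) => w Dw; case: ny; exists w.
pose ev (wn : seq bool * nat) :=
  foldr (fun (b : bool) x => if b then (d x).1 else (d x).2) (q wn.2) wn.1.
pose C k := if unpickle k is Some wn then ev wn else q 0.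
have evC wn : range C (ev wn) by exists (pickle wn) => //; rewrite /C pickleK.
have CE k : exists wn, C k = ev wn.
  by rewrite /C; case: unpickle => [wn|]; [exists wn|exists ([::], 0)].
exists C => [x y [k _ <-]|n]; last exact: (evC ([::], n)).
have [[w n] ->] := CE k => /dP[] ->; [exact: (evC (true :: w, n))|].
exact: (evC (false :: w, n)).
Qed.

(* With d n the join of x n and p (n even) or q (n odd), and b n the meet of
   d n.*2 and d n.*2.+1, all arrows along the paths from b n to x n.*2 and to
   x n.*2.+1 are reversed. *)
Lemma free_elements {D N l p q x} : orientation adj D -> out_closed D N ->
    N p -> N q -> p <> q -> sort p = ~~ sort l -> sort q = ~~ sort l ->
    ~ adj l p -> ~ adj l q -> injective x ->
    (forall n : nat, ~ N (x n) /\ only_out D (x n) l) ->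
  exists D' (b : nat -> V), [/\ orientation adj D', injective b,
    forall n, sort (b n) = ~~ sort l & forall n y, ~ D' (b n) y].
Proof.
move=> oD cN Np Nq pq sp sq lp lq x_inj xP.
have sx n : sort (x n) = ~~ sort l.
  by apply: (adj_sort pg); apply: (out_adj oD); apply/(xP n).2.
(* Alternating [p] and [q] keeps the out-neighbour [p] of [d n.*2] off [d n.*2.+1], as the second
   pass requires. *)
pose m0 n := if odd n then q else p.
have /choice[m mP] : forall v, exists w, forall n, v = x n -> w = m0 n.
  move=> v; have [[n vn]|nv] := pselect (exists n, v = x n).
    by exists (m0 n) => k; rewrite vn => /x_inj ->.
  by exists v => n vn; case: nv; exists n.
have [||D1 [c1 [oD1 DD1 D1E c1_inj _]]] :=
  @join_pass _ _ _ pg D N (range x) m oD cN.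
- move=> _ [n _ <-]; rewrite (mP _ n erefl); have [? xl] := xP n.
  split=> //; rewrite /m0; case: odd; rewrite ?sx //.
  + by move=> y /xl ->.
  + by move=> y /xl ->.
- by move=> _ [n _ <-]; exact: only_out_le1 (xP n).2.
pose d n := c1 (x n).
have d_inj : injective d.
  by move=> i j /c1_inj h; apply: x_inj; apply: h; [exists i|exists j].
have dP n : [/\ ~ N (d n), sort (d n) = sort l & only_out D1 (d n) (m0 n)].
  have [|? /(adj_sort pg) + + _ _] := D1E (x n); first by exists n.
  by rewrite sx negbK (mP _ n erefl).
have cN1 := same_closed cN DD1.
(* The second pass has the [d] of odd index as targets, so they are added to [N]; the only arrow of
   each goes to [q], which keeps the set closed. *)
pose N1 : set V := fun v => N v \/ exists n, v = d n.*2.+1.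
have cNd : out_closed D1 N1.
  move=> v w [Nv|[n ->]] Dvw; left; first exact: cN1 Dvw.
  by have [_ _ /(_ w)[h _]] := dP n.*2.+1; rewrite (h Dvw) /m0 /= odd_double.
have m0_even n : m0 n.*2 = p by rewrite /m0 odd_double.
have m0_odd n : m0 n.*2.+1 = q by rewrite /m0 /= odd_double.
have /choice[m1 m1P] : forall v, exists w, forall n, v = d n.*2 -> w = d n.*2.+1.
  move=> v; have [[n vn]|nv] := pselect (exists n, v = d n.*2).
    by exists (d n.*2.+1) => k; rewrite vn => /d_inj /double_inj ->.
  by exists v => n vn; case: nv; exists n.
have [||D2 [c2 [oD2 DD2 D2E c2_inj _]]] :=
  @join_pass _ _ _ pg D1 N1 (range (fun n => d n.*2)) m1 oD1 cNd.
- move=> _ [n _ <-]; rewrite (m1P _ n erefl).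
  have [nN sd dp] := dP n.*2; have [nN' sd' dq] := dP n.*2.+1.
  split; [by case=> // -[k /d_inj]; lia|by right; exists n|by rewrite sd sd'|].
  move=> y /dp ->; rewrite m0_even => /(adj_sym pg).
  by move=> /(adj_closed oD1 cN1 nN' Np) /dq; rewrite m0_odd.
- by move=> _ [n _ <-]; have [_ _ /only_out_le1] := dP n.*2.
pose b n := c2 (d n.*2).
have bP n : [/\ ~ N1 (b n), sort (b n) = ~~ sort l &
    only_out D2 (b n) (d n.*2.+1)].
  have [|? /(adj_sort pg) + + _ _] := D2E (d n.*2); first by exists n.
  by have [_ -> _] := dP n.*2; rewrite (m1P _ n erefl).
have b_inj : injective b.
  move=> i j bij; have [_ _ bi] := bP i; have [_ _ bj] := bP j.
  have /bi : D2 (b i) (d j.*2.+1) by rewrite bij; apply/bj.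
  by move=> /d_inj; lia.
have dN1 n : N1 (d n.*2.+1) by right; exists n.
have /choice[c3 c3P] : forall v, exists w, forall n, v = d n.*2.+1 -> w = b n.
  move=> v; have [[n vn]|nv] := pselect (exists n, v = d n.*2.+1).
    by exists (b n) => k; rewrite vn => /d_inj [] /double_inj ->.
  by exists v => n vn; case: nv; exists n.
have NN1 v : N v -> N1 v by left.
have cN2 : out_closed D2 N by apply: (same_closed cN1) => v /NN1; exact: DD2.
pose E := range (fun n => d n.*2.+1).
(* The last arrow of [b n] goes to [d n.*2.+1]; reversing it leaves [b n] without arrows. *)
exists (reverse D2 E c3), b; split; [|exact: b_inj| |].
- apply: (reverse_orientation pg oD2 cN2).
  + move=> _ [n _ <-]; rewrite (c3P _ n erefl).
    have [nN1 _ bd] := bP n; have [nN _ dq] := dP n.*2.+1; split=> //.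
    * exact/bd.
    * by move=> [k _ bk]; apply: nN1; rewrite -bk.
    * by move=> y z /DD2 Dy /DD2 Dz; apply: (only_out_le1 dq); auto.
  + move=> _ y [n _ <-]; rewrite (c3P _ n erefl).
    by have [_ _ bd] := bP n; move=> /bd; left.
  + move=> _ _ [i _ <-] [j _ <-]; rewrite (c3P _ i erefl) (c3P _ j erefl).
    by move=> /b_inj ->.
- by move=> n; have [] := bP n.
- move=> n y; have [nN1 _ bd] := bP n; move=> [[[k _ bk] _]|[/bd -> []]].
    by apply: nN1; rewrite -bk.
  by split; [exists n|rewrite (c3P _ n erefl)].
Qed.

End generation.

(** * Five-point bases *)

Section basis.
Context {V : Type} {adj : V -> V -> Prop} {sort : V -> bool}.
Hypothesis pg : plane_graph adj sort.
Implicit Types (D : V -> V -> Prop) (N E : set V).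

(* l, A, B, C are of one sort (lines, say) and p, q, r of the other; A, B, C are the
   sides opposite to p, q, r. *)
Record triangle_off (N : set V) (l p q r A B C : V) : Prop := TriangleOff {
  tri_mem : forall x, x = l \/ [\/ x = p, x = q | x = r] \/
    [\/ x = A, x = B | x = C] -> N x;
  tri_sort : [/\ sort p = ~~ sort l, sort q = ~~ sort l & sort r = ~~ sort l];
  tri_off : [/\ ~ adj l p, ~ adj l q & ~ adj l r];
  tri_A : adj A q /\ adj A r;
  tri_B : adj B p /\ adj B r;
  tri_C : adj C p /\ adj C q;
  tri_noncollinear : forall x, adj x p -> adj x q -> adj x r -> False
}.

(** The triangle supplies the targets for [normalize]: every line misses a vertex, and every point
    misses a side. Indeed a point on all three sides would be the vertex [q] where [A] and [C] meet,
    and then [B] would contain all three vertices. *)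
Lemma triangle_normalize {D N l p q r A B C} :
    triangle_off N l p q r A B C -> orientation adj D -> out_closed D N ->
  exists D', [/\ orientation adj D',
    forall x, N x -> forall y, D' x y <-> D x y &
    forall x, ~ N x -> two_out D' x \/ only_out D' x l].
Proof.
move=> [mem [sp sq sr] [lp lq lr] [Aq Ar] [Bp Br] [Cp Cq] noncol] oD cN.
have sl u m : adj m u -> sort u = ~~ sort l -> sort m = sort l.
  by move=> /(adj_sort pg) -> ->; rewrite negbK.
apply: (normalize pg oD cN).
- by apply: mem; left.
- move=> x _.
  have [xp|xp] := pselect (adj x p); last first.
    by exists p; split=> //; apply: mem; right; left; apply: Or31.
  have [xq|xq] := pselect (adj x q); last first.
    by exists q; split=> //; apply: mem; right; left; apply: Or32.
  have [xr|xr] := pselect (adj x r); first by case: (noncol x).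
  by exists r; split=> //; apply: mem; right; left; apply: Or33.
- move=> x _.
  have [xA|xA] := pselect (adj x A); last first.
    exists A; split=> //; last exact: sl Aq sq.
    by apply: mem; right; right; apply: Or31.
  have [xB|xB] := pselect (adj x B); last first.
    exists B; split=> //; last exact: sl Bp sp.
    by apply: mem; right; right; apply: Or32.
  have [xC|xC] := pselect (adj x C); last first.
    exists C; split=> //; last exact: sl Cp sp.
    by apply: mem; right; right; apply: Or33.
  have neqAC : A <> C by move=> eAC; apply: (noncol A) => //; rewrite eAC.
  have xq : x = q by apply: (join_unique pg neqAC) => //; exact: (adj_sym pg).
  by case: (noncol B) => //; apply: (adj_sym pg); rewrite -xq.
Qed.

(** The copy of the configuration inside the plane: [a 0] to [a 4] are its five points, [l] is its
    line, and [B] holds the further points on [l]. Only the first five terms of the sequence [a]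
    belong to it. *)
Record five_point_basis D (a : nat -> V) (l : V) (B : set V) : Prop :=
    FivePointBasis {
  basis_points_inj : injective a;
  basis_points_sort : forall n, sort (a n) = ~~ sort l;
  basis_points_out : forall n y, n < 5 -> ~ D (a n) y;
  basis_line_out : forall y, D l y <-> y = a 0 \/ y = a 1;
  basis_only_out : forall x, B x -> only_out D x l;
  basis_two_out : forall x, [\/ two_out D x, exists2 n, n < 5 & x = a n | B x]
}.

Lemma five_point_basis_exists {D l p q r A B C} : triangle_off setT l p q r A B C ->
    orientation adj D -> ~ countable [set: V] ->
  exists D' a l' X, [/\ orientation adj D', sort l' = sort l,
    five_point_basis D' a l' X &
    exists2 f : V -> V, injective f & forall x, X (f x)].
Proof.
move=> [_ srt off tA tB tC noncol] oD V_unc.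
(* The seven given elements lie in a countable closed set, so uncountability leaves infinitely many
   points outside whose only arrow goes to [l]. *)
have [C0 cC0 C0q] := countable_out_closed (nth l [:: l; p; q; r; A; B; C]) oD.
pose M := range C0.
have M0 : triangle_off M l p q r A B C.
  split=> // x [->|[[]->|[]->]].
  - exact: (C0q 0).
  - exact: (C0q 1).
  - exact: (C0q 2).
  - exact: (C0q 3).
  - exact: (C0q 4).
  - exact: (C0q 5).
  - exact: (C0q 6).
have [D1 [oD1 DD1 D1P]] := triangle_normalize M0 oD cC0.
have cM1 := same_closed cC0 DD1.
have B_inf : infinite_set [set x | ~ M x /\ only_out D1 x l].
  apply: (free_infinite pg (C := C0) oD1 V_unc) => x n2.
  have [[n _ <-]|nMx] := pselect (M x); first by left; exists n.
  by right; split=> //; have [/n2|] := D1P _ nMx.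
have [x x_inj xP] := infinite_sequence B_inf.
have [Mp Mq] : M p /\ M q.
  by split; apply: (tri_mem _ _ _ _ _ _ _ _ M0); right; left;
    [apply: Or31|apply: Or32].
have pq : p <> q.
  by move=> pq; have [Bp Br] := tB; apply: (noncol B) => //; rewrite -pq.
have [sp sq _] := srt; have [lp lq _] := off.
have [D2 [a [oD2 a_inj sa aP]]] :=
  free_elements pg oD1 cM1 Mp Mq pq sp sq lp lq x_inj xP.
(* Every edge at a point without arrows points towards it, so two such points use up the arrows of
   their join. *)
have line i j : i != j -> exists m, [/\ sort m = sort l, adj m (a i), adj m (a j) &
    forall y, D2 m y <-> y = a i \/ y = a j].
  move=> /eqP ij; have aij : a i <> a j by move=> /a_inj.
  have [|m [mi mj]] := join_exists pg aij; first by rewrite !sa.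
  have Dm k : adj m (a k) -> D2 m (a k) by move=> /(adj_out oD2)[//|/aP].
  exists m; split=> //; first by rewrite (adj_sort pg mi) sa negbK.
  move=> y; split=> [Dy|[]->]; [|exact: Dm..].
  by have [//|<-|<-] := out_le2 oD2 (Dm _ mi) (Dm _ mj) Dy; [left|right].
have [l' [sl' la0 la1 l'P]] := line 0 1 isT.
have [A' [_ A3 A4 A'P]] := line 3 4 isT.
have [B' [_ B2 B4 B'P]] := line 2 4 isT.
have [C' [_ C2 C3 C'P]] := line 2 3 isT.
pose N : set V := fun x => (exists2 n, n < 5 & x = a n) \/
  x = l' \/ [\/ x = A', x = B' | x = C'].
have Na n : n < 5 -> N (a n) by left; exists n.
have cN : out_closed D2 N.
  by move=> u v [[n _ ->] /aP//|[->|[]->]] => [/l'P|/A'P|/B'P|/C'P] [] ->; apply: Na.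
have Dadj u n : adj u (a n) -> D2 u (a n) by move=> /(adj_out oD2)[//|/aP].
(* A line contains at most two points without arrows, so the vertices [a 2], [a 3], [a 4] are off
   [l'] and not collinear. *)
have N0 : triangle_off N l' (a 2) (a 3) (a 4) A' B' C'.
  split; rewrite ?sl' ?sa //.
  - by move=> u [->|[[]->|h]]; [right; left|apply: Na..|right; right].
  - by split=> /Dadj/l'P[] /a_inj.
  - move=> u /Dadj h2 /Dadj h3 /Dadj h4.
    by have [] := out_le2 oD2 h2 h3 h4 => /a_inj.
have [D3 [oD3 DD3 D3P]] := triangle_normalize N0 oD2 cN.
pose X := [set x | ~ N x /\ only_out D3 x l'].
have a_neq i j : i <> j -> a i <> a j by move=> ij /a_inj.
have two m i j : i != j -> (forall y, D2 m y <-> y = a i \/ y = a j) -> N m ->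
    two_out D3 m.
  move=> /eqP ij mP Nm; exists (a i), (a j); split; first exact: a_neq.
    by apply/DD3 => //; apply/mP; left.
  by apply/DD3 => //; apply/mP; right.
have cover x0 : [\/ two_out D3 x0, exists2 n, n < 5 & x0 = a n | X x0].
  have [Nx|nNx] := pselect (N x0); last first.
    have [?|?] := D3P _ nNx; first by apply: Or31.
    by apply: Or33.
  case: (Nx) => [h|[e|[]e]]; first (by apply: Or32); apply: Or31; subst x0.
  - exact: (two _ 0 1 isT l'P Nx).
  - exact: (two _ 3 4 isT A'P Nx).
  - exact: (two _ 2 4 isT B'P Nx).
  - exact: (two _ 2 3 isT C'P Nx).
have cover' x0 : ~ two_out D3 x0 -> (exists n, a n = x0) \/ X x0.
  by case: (cover x0) => [|[n _ ->]|]; [|left; exists n|right].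
(* Terms over the [a n] and [X] reach every element, which shows first that [X] is infinite and then
   that it is as large as [V]. *)
have X_inf := free_infinite pg oD3 V_unc cover'.
have [f f_inj fX] := free_card pg oD3 X_inf cover'.
exists D3, a, l', X; split=> //; last by exists f.
split=> //.
- by move=> n; rewrite sl' sa.
- by move=> n y n5 /(DD3 _ (Na _ n5)) /aP.
- by move=> y; rewrite DD3 //; right; left.
- by move=> y [_].
Qed.

End basis.

(** * Free completions *)

Definition is_point {P : incidence} (x : elt P) : bool :=
  if x is inl _ then true else false.

Lemma adjacent_sym {P : incidence} (x y : elt P) : adjacent x y -> adjacent y x.
Proof. by case: x y => [p|l] [q|m]. Qed.

Lemma adjacent_sort {P : incidence} (x y : elt P) : adjacent x y ->
  is_point x = ~~ is_point y.
Proof. by case: x y => [p|l] [q|m]. Qed.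

(** * Walks in graphs *)

Section walks.
Context {V : Type} {adj : V -> V -> Prop}.

Lemma walk_cat {m n a b c} : walk adj m a b -> walk adj n b c ->
  walk adj (m + n) a c.
Proof.
elim: m a => [|m IH] a /=; first by move=> ->.
by move=> [d [ad db]] bc; exists d; split=> //; exact: IH.
Qed.

Lemma walk_split {m n a c} : walk adj (m + n) a c ->
  exists b, walk adj m a b /\ walk adj n b c.
Proof.
elim: m a => [|m IH] a /=; first by exists a.
by move=> [d [ad /IH[b [db bc]]]]; exists b; split=> //; exists d.
Qed.

Lemma walk_map {W : Type} {adj' : W -> W -> Prop} {f : V -> W} {n a b} :
  (forall x y, adj x y -> adj' (f x) (f y)) -> walk adj n a b ->
  walk adj' n (f a) (f b).
Proof.
move=> f_adj; elim: n a => [|n IH] a /=; first by move=> ->.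
by move=> [c [/f_adj ac /IH cb]]; exists (f c).
Qed.

End walks.

Lemma walk_sort {P : incidence} {n} {a b : elt P} :
  walk (@adjacent P) n a b -> is_point a = is_point b (+) odd n.
Proof.
elim: n a => [|n IH] a /=; first by move=> ->; rewrite addbF.
by move=> [c [/adjacent_sort -> /IH ->]]; rewrite addbN.
Qed.

Lemma unjoined_nwalk2 {P : incidence} {a b : elt P} : unjoined a b ->
  ~ walk (@adjacent P) 2 a b.
Proof. by move=> [[_ h]|h]; apply: h. Qed.

Lemma unjoined_neq {P : incidence} {a b : elt P} : unjoined a b -> a <> b.
Proof. by move=> [[_ h]|h] ab; [apply: (h 0)|apply: (h 0)]. Qed.

(** * One step of the free completion *)

Section free_step.
Context {P : incidence}.

Definition old (x : elt P) : elt (free_step P) :=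
  match x with inl p => inl (inl p) | inr l => inr (inl l) end.

Definition is_new (x : elt (free_step P)) : Prop :=
  match x with inl (inr _) | inr (inr _) => True | _ => False end.

Lemma old_or_new x : (exists y, x = old y) \/ is_new x.
Proof.
case: x => [[p|s]|[l|s]]; try by right.
- by left; exists (inl p).
- by left; exists (inr l).
Qed.

Lemma is_point_old x : is_point (old x) = is_point x.
Proof. by case: x. Qed.

Lemma adjacent_old x y : adjacent (old x) (old y) <-> adjacent x y.
Proof. by case: x y => [p|l] [q|m]. Qed.

Lemma new_adjacent x : is_new x -> exists a b : elt P,
  [/\ unjoined a b, is_point a = is_point b, is_point x = ~~ is_point a &
      forall y, adjacent x (old y) <-> y = a \/ y = b].
Proof.
case: x => [[p|[S [a [b [ab Sab]]]]]|[l|[S [a [b [ab Sab]]]]]] // _.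
  exists (inr a), (inr b); split=> // -[q|m] /=; first by split=> // -[].
  by rewrite Sab; split=> -[] => [->|->|[->]|[->]]; [left|right|left|right].
exists (inl a), (inl b); split=> // -[q|m] /=; last by split=> // -[].
by rewrite Sab; split=> -[] => [->|->|[->]|[->]]; [left|right|left|right].
Qed.

Lemma new_not_adjacent x x' : is_new x -> is_new x' -> ~ adjacent x x'.
Proof. by case: x x' => [[p|s]|[l|s]] [[p'|s']|[l'|s']] //= _ _ []. Qed.

Lemma new_ext x x' : is_new x -> is_new x' -> is_point x = is_point x' ->
  (forall y, adjacent x (old y) <-> adjacent x' (old y)) -> x = x'.
Proof.
case: x x' => [[p|[S Sp]]|[l|[S Sp]]] [[p'|[S' Sp']]|[l'|[S' Sp']]] //= _ _ _ h.
  by congr (inl (inr _)); apply: eq_exist; apply/seteqP; split=> m /(h (inr m)).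
by congr (inr (inr _)); apply: eq_exist; apply/seteqP; split=> m /(h (inl m)).
Qed.

Lemma new_exists {a b : elt P} : unjoined a b -> is_point a = is_point b ->
  exists x, adjacent x (old a) /\ adjacent x (old b).
Proof.
case: a b => [a|a] [b|b] // ab _.
  pose s : new_line P :=
    exist _ [set a; b] (ex_intro _ a (ex_intro _ b (conj ab erefl))).
  by exists (inr (inr s)); split; [left|right].
pose s : new_point P :=
    exist _ [set a; b] (ex_intro _ a (ex_intro _ b (conj ab erefl))).
by exists (inl (inr s)); split; [left|right].
Qed.

End free_step.

(** * Embeddings of the free completion *)

Section embedding.
Context {A : incidence} {D : elt A -> elt A -> Prop}.
Hypothesis pg : plane_graph (@adjacent A) is_point.
Hypothesis oD : orientation (@adjacent A) D.

(** The invariant of the stages: the image is a closed full subgraph, and each element outside it is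
    the join of two out-neighbours. *)
Record free_embedding {P : incidence} (h : elt P -> elt A) : Prop :=
    FreeEmbedding {
  emb_sort : forall x, is_point (h x) = is_point x;
  emb_inj : injective h;
  emb_adj : forall x y, adjacent (h x) (h y) <-> adjacent x y;
  emb_closed : out_closed D (range h);
  emb_two_out : forall x, ~ range h x -> two_out D x
}.

(** The element added for [a] and [b] goes to the join of [h a] and [h b]. This lies outside the
    range of [h], as [a] and [b] have no common neighbour, so its arrows go exactly to [h a] and
    [h b]. They determine the new element, and no edge joins two new images, since it would be an
    arrow of one of them. *)
Lemma free_embedding_step {P : incidence} {h : elt P -> elt A} :
    free_embedding h ->
  exists h' : elt (free_step P) -> elt A,
    free_embedding h' /\ forall x, h' (old x) = h x.
Proof.
move=> [h_sort h_inj h_adj h_closed h_two].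
have /choice[h' h'P] : forall x : elt (free_step P), exists c,
    (forall y, x = old y -> c = h y) /\
    (is_new x -> forall y, adjacent x (old y) -> adjacent c (h y)).
  move=> x; have [[y ->]|nx] := old_or_new x.
    exists (h y); split=> [z|]; last by case: y.
    by case: y z => [y|y] [z|z] //= [->].
  have [a [b [ab sab _ xab]]] := new_adjacent x nx.
  have hab : h a <> h b by move=> /h_inj; exact: unjoined_neq.
  have [|c [ca cb]] := join_exists pg hab; first by rewrite !h_sort.
  exists c; split=> [y xy|_ y /xab[]->//].
  by move: nx; rewrite xy; case: (y).
have h'old y : h' (old y) = h y by apply: (h'P _).1.
have h'new x : is_new x -> exists a b, [/\ is_point x = ~~ is_point a,
    forall y, adjacent x (old y) <-> y = a \/ y = b,
    adjacent (h' x) (h a), ~ range h (h' x) &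
    forall z, D (h' x) z <-> z = h a \/ z = h b].
  move=> nx; have [a [b [ab sab xa xab]]] := new_adjacent x nx.
  have h'a : adjacent (h' x) (h a) by apply: (h'P _).2 => //; apply/xab; left.
  have h'b : adjacent (h' x) (h b) by apply: (h'P _).2 => //; apply/xab; right.
  have nr : ~ range h (h' x).
    move=> [z _ zx]; apply: (unjoined_nwalk2 ab); exists z; split.
      by apply: adjacent_sym; apply/h_adj; rewrite zx.
    by exists b; split=> //; apply/h_adj; rewrite zx.
  have Da : D (h' x) (h a) by apply: (adj_closed oD h_closed).
  have Db : D (h' x) (h b) by apply: (adj_closed oD h_closed).
  exists a, b; split=> // z; split=> [Dz|[]->//].
  have [/h_inj e|<-|<-] := out_le2 oD Da Db Dz; [|by left|by right].
  by case: (unjoined_neq ab).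
have new_old x y : is_new x -> adjacent (h' x) (h y) <-> adjacent x (old y).
  move=> /h'new[a [b [xa xab _ nr Dx]]]; rewrite xab.
  have -> : adjacent (h' x) (h y) <-> D (h' x) (h y).
    by split=> [|/(out_adj oD)//]; apply: (adj_closed oD h_closed).
  by rewrite Dx; split=> -[] => [/h_inj|/h_inj|->|->]; tauto.
have h'_sort x : is_point (h' x) = is_point x.
  have [[y ->]|/h'new[a [b [-> _ h'a _ _]]]] := old_or_new x.
    by rewrite h'old h_sort is_point_old.
  by rewrite (adjacent_sort _ _ h'a) h_sort.
have sub z : range h z -> range h' z.
  by move=> [y _ <-]; exists (old y).
have n2 x x' : is_new x -> is_new x' -> ~ D (h' x) (h' x').
  move=> /h'new[a [b [_ _ _ _ Dx]]] /h'new[_ [_ [_ _ _ nr _]]] /Dx[] e;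
    by apply: nr; rewrite e; eexists.
exists h'; split=> //; split=> //.
- move=> x x'; have [[y ->]|nx] := old_or_new x;
    have [[y' ->]|nx'] := old_or_new x'; rewrite ?h'old.
  + by move=> /h_inj ->.
  + move=> e; have [? [? [_ _ _ nr _]]] := h'new _ nx'.
    by case: nr; rewrite -e; eexists.
  + move=> e; have [? [? [_ _ _ nr _]]] := h'new _ nx.
    by case: nr; rewrite e; eexists.
  + move=> e; apply: new_ext => // [|y]; first by rewrite -!h'_sort e.
    by rewrite -!new_old // e.
- move=> x x'; have [[y ->]|nx] := old_or_new x;
    have [[y' ->]|nx'] := old_or_new x'; rewrite ?h'old.
  + by rewrite h_adj adjacent_old.
  + split=> /adjacent_sym; first by move=> /(new_old _ _ nx') /adjacent_sym.
    by move=> /(new_old _ _ nx') /adjacent_sym.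
  + exact: new_old.
  + split=> [/(adj_out oD)[/n2 []//|/n2 []//]|].
    by move=> h2; case: (new_not_adjacent _ _ nx nx').
- move=> _ z [x _ <-]; have [[y ->]|/h'new[a [b [_ _ _ _ Dx]]]] := old_or_new x.
    by rewrite h'old => Dyz; apply: sub; apply: h_closed Dyz; exists y.
  by move=> /Dx[] ->; apply: sub; eexists.
- by move=> x nx; apply: h_two => /sub.
Qed.

Section stages.
Context {P : incidence} {h0 : elt P -> elt A}.
Hypothesis h0P : free_embedding h0.

(** The invariant travels with the map, because it is needed to choose the next extension. *)
Fixpoint stage_embedding (n : nat) :
    {h : elt (stage P n) -> elt A | free_embedding h} :=
  match n with
  | 0 => exist _ h0 h0P
  | m.+1 =>
      let: exist h' h'P := cid (free_embedding_step (svalP (stage_embedding m))) in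
      exist _ h' h'P.1
  end.

Definition emb (n : nat) : elt (stage P n) -> elt A := sval (stage_embedding n).

Lemma embP n : free_embedding (emb n).
Proof. exact: svalP. Qed.

Lemma emb_old {n} (x : elt (stage P n)) :
  emb n.+1 (old x : elt (stage P n.+1)) = emb n x.
Proof. by rewrite /emb /=; case: cid => h' [? ?] /=. Qed.

Lemma emb_lift {n m} (x : elt (stage P n)) : n <= m -> exists y, emb m y = emb n x.
Proof.
move=> /subnK <-; elim: (m - n) => [|k [y <-]]; first by exists x.
by exists (old y : elt (stage P (k + n).+1)); exact: emb_old.
Qed.

(* A free step only joins elements at distance 4 or infinity.  A longer walk is
   shortened in the next stage by joining its elements of index 0 and 4. *)
Lemma emb_join {n} (u v : elt (stage P n)) : u <> v -> is_point u = is_point v ->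
  exists m w, adjacent (emb m w) (emb n u) /\ adjacent (emb m w) (emb n v).
Proof.
move=> uv suv.
have new a b : unjoined a b -> is_point a = is_point b ->
    exists w : elt (stage P n.+1), adjacent w (old a) /\ adjacent w (old b).
  exact: new_exists.
have [[k uvk]|inf] := pselect (exists k, walk (@adjacent (stage P n)) k u v);
    last first.
  have [|w [wu wv]] := new u v _ suv.
    by right=> k h; apply: inf; exists k.
  exists n.+1, w; rewrite -(emb_old u) -(emb_old v).
  by split; apply/(emb_adj _ (embP n.+1)).
(* The stage [n] is generalised too, since shortening the walk may lead to the next stage. *)
move: k n u v uv suv {new} uvk.
elim/ltn_ind => k IH n u v uv suv uvk.
have [k4|k4] := ltnP k 4.
  case: k k4 {IH} uvk => [|[|[|[|k]]]] //.
  - by move=> _ /walk_sort; rewrite suv; case: is_point.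
  - move=> _ [w [uw [x [wx xv]]]]; rewrite {}xv in wx; exists n, w.
    by split; apply/(emb_adj _ (embP n)) => //; exact: adjacent_sym.
  - by move=> _ /walk_sort; rewrite suv; case: is_point.
have kE : k = 4 + (k - 4) by rewrite subnKC.
move: uvk; rewrite kE => /walk_split[c [uc cv]].
have sc : is_point u = is_point c by rewrite (walk_sort uc) addbF.
(* Either a walk of length below 4 from [u] to [c] shortens the whole in the same stage, or their
   distance is exactly 4 and the next stage joins them. *)
have [[m [m4 ucm]]|nm] :=
    pselect (exists m, m < 4 /\ walk (@adjacent (stage P n)) m u c).
  apply: (IH (m + (k - 4))) => //; first lia.
  exact: walk_cat ucm cv.
have [|w [wu wc]] := @new_exists (stage P n) u c _ sc.
  by left; split=> // m m4 h; apply: nm; exists m.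
rewrite -(emb_old u) -(emb_old v).
apply: (IH (2 + (k - 4))) => //; first lia.
- by move=> e; apply: uv; move: u v e {IH suv uc cv sc nm wu} => [u|u] [v|v] //= [->].
- by rewrite !is_point_old.
- apply: (walk_cat (b := old c)).
    by exists w; split; [exact: adjacent_sym|exists (old c)].
  by apply: walk_map cv => x y; rewrite adjacent_old.
Qed.

(** By induction along [D]: the two out-neighbours of an element outside the range of [h0] lie in a
    common stage, they acquire a join in some stage, and joins are unique. *)
Lemma emb_surj x : exists n y, emb n y = x.
Proof.
elim/(well_founded_ind (out_wf oD)): x => x IH.
have [[y _ yx]|/(emb_two_out _ h0P)] := pselect (range h0 x).
  by exists 0, y.
move=> [y [z [yz Dy Dz]]].
have [n1 [y1 ey]] := IH _ Dy; have [n2 [z1 ez]] := IH _ Dz.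
have [y2 ey2] := emb_lift y1 (leq_maxl n1 n2).
have [z2 ez2] := emb_lift z1 (leq_maxr n1 n2).
have xy := out_adj oD Dy; have xz := out_adj oD Dz.
have [||m [w [wy wz]]] := emb_join y2 z2.
- by move=> e; apply: yz; rewrite -ey -ez -ey2 -ez2 e.
- rewrite -!(emb_sort _ (embP _)) ey2 ez2 ey ez.
  by apply: negb_inj; rewrite -(adjacent_sort _ _ xy) -(adjacent_sort _ _ xz).
exists m, w; apply: (join_unique pg yz) => //.
- by move: wy; rewrite ey2 ey.
- by move: wz; rewrite ez2 ez.
Qed.

Definition in_stage (x : elt (free_completion P)) (n : nat)
    (z : elt (stage P n)) : Prop :=
  match x, z with
  | inl x, inl p => point_in_stage x p
  | inr y, inr l => line_in_stage y l
  | _, _ => False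
  end.

Lemma in_stage_old {x n} (z : elt (stage P n)) : in_stage x n z ->
  in_stage x n.+1 (old z).
Proof. by case: x z => [x|y] [p|l] //= h; constructor. Qed.

Lemma in_stage_lift {x n m} (z : elt (stage P n)) : n <= m -> in_stage x n z ->
  exists z', in_stage x m z'.
Proof.
move=> /subnK <- xz; elim: (m - n) => [|k [y xy]]; first by exists z.
by exists (old y); exact: in_stage_old.
Qed.

Lemma in_stage_exists x : exists n z, in_stage x n z.
Proof.
case: x => [x|y].
  by exists (projT1 x), (inl (point_at_birth (projT2 x))); constructor.
by exists (projT1 y), (inr (line_at_birth (projT2 y))); constructor.
Qed.

(** Strips the inclusions [inl] until the stage where the point first appears. *)
Fixpoint birth_point (n : nat) : points (stage P n) -> {n & born_point P n} :=
  match n with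
  | 0 => fun p => existT (born_point P) 0 p
  | m.+1 => fun p => match p with
                     | inl p => birth_point m p
                     | inr s => existT (born_point P) m.+1 s
                     end
  end.

Fixpoint birth_line (n : nat) : lines (stage P n) -> {n & born_line P n} :=
  match n with
  | 0 => fun l => existT (born_line P) 0 l
  | m.+1 => fun l => match l with
                     | inl l => birth_line m l
                     | inr s => existT (born_line P) m.+1 s
                     end
  end.

Definition birth (n : nat) (z : elt (stage P n)) : elt (free_completion P) :=
  match z with inl p => inl (birth_point n p) | inr l => inr (birth_line n l) end.

Lemma in_stage_birth n z : in_stage (birth n z) n z.
Proof.
case: z => /=.
  elim: n => [|n IH] p; first exact: (point_in_birth_stage (existT (born_point P) 0 p)).
  case: p => [p|s] /=; first by constructor; exact: IH.
  exact: (point_in_birth_stage (existT (born_point P) n.+1 s)).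
elim: n => [|n IH] p; first exact: (line_in_birth_stage (existT (born_line P) 0 p)).
case: p => [p|s] /=; first by constructor; exact: IH.
exact: (line_in_birth_stage (existT (born_line P) n.+1 s)).
Qed.

Lemma birth_in_stage {x n z} : in_stage x n z -> birth n z = x.
Proof.
case: x z => [x|y] [p|l] //= h; congr (_ _).
  by elim: h => //; case: x => [[|n']].
by elim: h => //; case: y => [[|n']].
Qed.

(** Evaluation at the stage of birth; by [emb_old] any later stage gives the same value. *)
Definition completion_map (x : elt (free_completion P)) : elt A :=
  match x with
  | inl x => emb (projT1 x) (inl (point_at_birth (projT2 x)))
  | inr y => emb (projT1 y) (inr (line_at_birth (projT2 y)))
  end.

Lemma completion_map_in_stage {x n z} : in_stage x n z ->
  completion_map x = emb n z.
Proof.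
case: x z => [x|y] [p|l] //= h; elim: h => // k q _ ->; symmetry.
  exact: (emb_old (inl q)).
exact: (emb_old (inr q)).
Qed.

Lemma completion_map_sort x : is_point (completion_map x) = is_point x.
Proof. by case: x => [x|y] /=; rewrite (emb_sort _ (embP _)). Qed.

Lemma completion_map_surj c : exists x, completion_map x = c.
Proof.
have [n [z <-]] := emb_surj c; exists (birth n z).
exact: (completion_map_in_stage (in_stage_birth n z)).
Qed.

Lemma in_stage2 x y : exists n z w, in_stage x n z /\ in_stage y n w.
Proof.
have [n [z xz]] := in_stage_exists x; have [m [w yw]] := in_stage_exists y.
have [z' xz'] := in_stage_lift z (leq_maxl n m) xz.
have [w' yw'] := in_stage_lift w (leq_maxr n m) yw.
by exists (maxn n m), z', w'.
Qed.

Lemma completion_map_inj : injective completion_map.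
Proof.
move=> x y; have [n [z [w [xz yw]]]] := in_stage2 x y.
rewrite (completion_map_in_stage xz) (completion_map_in_stage yw).
move=> /(emb_inj _ (embP n)) zw.
by rewrite -(birth_in_stage xz) -(birth_in_stage yw) zw.
Qed.

Lemma completion_map_adj x y :
  adjacent (completion_map x) (completion_map y) <-> adjacent x y.
Proof.
have adjE x1 y1 : adjacent (inl x1 : elt (free_completion P)) (inr y1) <->
    adjacent (completion_map (inl x1)) (completion_map (inr y1)).
  split=> [[n [p [l [xp yl pl]]]]|].
    rewrite (@completion_map_in_stage (inl x1) n (inl p) xp).
    rewrite (@completion_map_in_stage (inr y1) n (inr l) yl).
    exact/(emb_adj _ (embP n)).
  have [n [[p|l] [[q|m] [xz yw]]]] := in_stage2 (inl x1) (inr y1);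
    [by case: yw| |by case: xz|by case: xz].
  rewrite (@completion_map_in_stage (inl x1) n (inl p) xz).
  rewrite (@completion_map_in_stage (inr y1) n (inr m) yw).
  by move=> /(emb_adj _ (embP n)) pm; exists n, p, m.
have same u v : is_point u = is_point v ->
    adjacent (completion_map u) (completion_map v) <-> adjacent u v.
  by move=> uv; split=> /adjacent_sort; rewrite ?completion_map_sort uv;
    case: is_point.
case: x y => [x|x] [y|y]; [exact: same|by rewrite adjE| |exact: same].
split=> /adjacent_sym h; apply: adjacent_sym; first by apply/adjE.
by move/adjE: h.
Qed.

Lemma free_completion_iso : isomorphic A (free_completion P).
Proof.
have sortP c x : completion_map x = c -> is_point x = is_point c.
  by move=> <-; rewrite completion_map_sort.
have /choice[f fP] : forall p : points A, exists x, completion_map (inl x) = inl p.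
  by move=> p; have [[x|y] h] := completion_map_surj (inl p);
    [exists x|have := sortP _ _ h].
have /choice[g gP] : forall l : lines A, exists y, completion_map (inr y) = inr l.
  by move=> p; have [[x|y] h] := completion_map_surj (inr p);
    [have := sortP _ _ h|exists y].
exists f, g; split.
- have /choice[f' f'P] : forall x, exists p, completion_map (inl x) = inl p.
    move=> x; case e : (completion_map (inl x)) => [p|l]; first by exists p.
    by have := sortP _ _ e.
  exists f' => x; first by have := fP x; rewrite f'P => -[].
  by have := fP (f' x); rewrite -f'P => /completion_map_inj[].
- have /choice[g' g'P] : forall x, exists p, completion_map (inr x) = inr p.
    move=> x; case e : (completion_map (inr x)) => [p|l]; last by exists l.
    by have := sortP _ _ e.
  exists g' => x; first by have := gP x; rewrite g'P => -[].
  by have := gP (g' x); rewrite -g'P => /completion_map_inj[].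
- move=> p l; have := completion_map_adj (inl (f p)) (inr (g l)).
  by rewrite fP gP.
Qed.

End stages.
End embedding.

(** * Projective planes *)

Section projective_plane.
Context {A : incidence}.
Hypothesis A_plane : projective_plane A.

(** Two distinct elements of the same sort have even distance at most 3, hence 2, which gives a
    join; two different joins would close a 4-cycle against girth 6. *)
Lemma projective_plane_graph : plane_graph (@adjacent A) is_point.
Proof.
have [[_ girth] [diam _] _] := A_plane; split.
- exact: adjacent_sym.
- exact: adjacent_sort.
- move=> x y xy sxy; have [n n3 [w _]] := diam x y.
  have := walk_sort w; rewrite sxy; case: n n3 w => [|[|[|[|n]]]] //=.
  + by move=> _ _; case: is_point.
  + move=> _ [z [xz [y' [zy y'y]]]] _; rewrite {}y'y in zy.
    by exists z; split=> //; exact: adjacent_sym.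
  + by move=> _ _; case: is_point.
- move=> x y z w xy zx zy wx wy; apply: contrapT => zw.
  have ns (u v : elt A) : adjacent u v -> u <> v.
    by move=> + uv; rewrite uv => /adjacent_sort; case: is_point.
  pose c (i : 'I_4) := match val i with 0 => x | 1 => z | 2 => y | _ => w end.
  suff : 6 <= 4 by [].
  apply: girth; split=> //; exists c; split.
    have [zx' zy' wx' wy'] := And4 (ns _ _ zx) (ns _ _ zy) (ns _ _ wx) (ns _ _ wy).
    move=> [[|[|[|[|i]]]] Hi] [[|[|[|[|j]]]] Hj] //=; rewrite /c /= => e;
      try (by apply: val_inj);
      by [case: xy|case: zw|case: zx'|case: zy'|case: wx'|case: wy'].
  by move=> [[|[|[|[|i]]]] Hi] //=; rewrite /c //=; apply: adjacent_sym.
Qed.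

Lemma third_neighbour (a u v : elt A) :
  exists w, [/\ adjacent a w, w <> u & w <> v].
Proof.
have [_ _ /(_ a) /card_le_inj[f f_inj]] := A_plane.
have I3 i : i < 3 -> i \in `I_3 by move=> i3; exact/mem_set.
pose b i (i3 : i < 3) := set_val (f (exist _ i (I3 i i3))).
have ab i i3 : adjacent a (b i i3) by exact: (set_valP (f _)).
have b_inj i j i3 j3 : b i i3 = b j j3 -> i = j.
  by move=> /val_inj /f_inj [].
apply: contrapT => n.
have h i i3 : b i i3 = u \/ b i i3 = v.
  apply: contrapT => /not_orP[bu bv]; apply: n.
  by exists (b i i3).
have [h0 h1 h2] := And3 (h 0 isT) (h 1 isT) (h 2 isT).
by case: h0 h1 h2 => e0 [] e1 [] e2;
  [have := b_inj 0 1 isT isT|have := b_inj 0 1 isT isT|have := b_inj 0 2 isT isT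
  |have := b_inj 1 2 isT isT|have := b_inj 1 2 isT isT|have := b_inj 0 2 isT isT
  |have := b_inj 0 1 isT isT|have := b_inj 0 1 isT isT];
  rewrite ?e0 ?e1 ?e2 => /(_ erefl).
Qed.

(** Take [p] and [q] on a second line [m] through a point [u] of [l], and [r] on the line [m']
    joining [p] to another point [v] of [l], all different from [u] and [v]. The sides are [k]
    through [q] and [r], then [m'] and [m]. *)
Lemma triangle_exists : exists l p q r B C1 C2,
  ~~ is_point l /\
  triangle_off (adj := @adjacent A) (sort := is_point) setT l p q r B C1 C2.
Proof.
have pg := projective_plane_graph.
have line_unique := fun x y z w => @join_unique _ _ _ pg x y z w.
have [l sl] : exists l : elt A, ~~ is_point l.
  have [_ [_ [a _]] _] := A_plane.
  case: (boolP (is_point a)) => sa; last by exists a.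
  have [w [aw _ _]] := third_neighbour a a a.
  by exists w; rewrite -(adjacent_sort _ _ aw).
have off u m p : adjacent l u -> adjacent m u -> m <> l -> adjacent m p ->
    p <> u -> ~ adjacent l p.
  by move=> lu mu ml mp pu lp; apply: ml; exact: (line_unique p u).
have [u [lu _ _]] := third_neighbour l l l.
have [m [um ml _]] := third_neighbour u l l.
have mu := adjacent_sym _ _ um.
have [p [mp pu _]] := third_neighbour m u u.
have lp := off u m p lu mu ml mp pu.
have [q [mq qu qp]] := third_neighbour m u p.
have lq := off u m q lu mu ml mq qu.
have [v [lv vu _]] := third_neighbour l u u.
have vp : v <> p by move=> vp; apply: lp; rewrite -vp.
have sm : is_point m = is_point l.
  by apply: negb_inj; rewrite -(adjacent_sort _ _ um) (adjacent_sort _ _ lu) negbK.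
have sl_out x : adjacent l x -> is_point x = ~~ is_point l.
  by move=> /adjacent_sym /adjacent_sort.
have sm_out x : adjacent m x -> is_point x = ~~ is_point l.
  by move=> /adjacent_sym /adjacent_sort; rewrite sm.
have [|m' [m'v m'p]] := join_exists pg vp.
  by rewrite (sl_out _ lv) (sm_out _ mp).
have m'l : m' <> l by move=> e; apply: lp; rewrite -e.
have [r [m'r rv rp]] := third_neighbour m' v p.
have lr := off v m' r lv m'v m'l m'r rv.
have mm' : m <> m'.
  by move=> e; apply: ml; apply: (line_unique u v) => //; [exact/nesym|rewrite e].
have sr : is_point r = ~~ is_point l.
  rewrite (adjacent_sort _ _ (adjacent_sym _ _ m'r)) (adjacent_sort _ _ m'p).
  by rewrite (sm_out _ mp) negbK.
have noncol x : adjacent x p -> adjacent x q -> adjacent x r -> False.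
  move=> xp xq xr; apply: mm'.
  have xm : x = m by exact: (line_unique q p).
  have xm' : x = m' by exact: (line_unique r p).
  by rewrite -xm.
have qr : q <> r.
  by move=> e; apply: (noncol m) => //; rewrite -e.
have [|k [kq kr]] := join_exists pg qr; first by rewrite sr (sm_out _ mq).
exists l, p, q, r, k, m', m; split=> //; split=> //.
by split=> //; apply: sm_out.
Qed.

End projective_plane.

(** * From HF-orders to the isomorphism *)

Lemma HF_orientation {A : incidence} {lt : elt A -> elt A -> Prop} :
  wellfounded_HF_order lt ->
  orientation (@adjacent A) (fun x y => adjacent x y /\ lt y x).
Proof.
move=> [_ _ tot wf le2]; split.
- by move=> x y [].
- move=> x y xy; have [xy'|e|yx] := tot x y.
  + by right; split=> //; exact: adjacent_sym.
  + by move: xy; rewrite e => /adjacent_sort; case: is_point.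
  + by left.
- move=> x y1 y2 y3 D1 D2 D3.
  have /card_le_inj[f f_inj] := le2 x.
  pose g y (Dy : adjacent x y /\ lt y x) := set_val (f (exist _ y (mem_set Dy))).
  have g2 y Dy : g y Dy < 2 by exact: (set_valP (f _)).
  have g_inj y z Dy Dz : g y Dy = g z Dz -> y = z.
    by move=> /val_inj /f_inj [].
  have [e|n12] := pselect (g _ D1 = g _ D2); first by apply: Or31; exact: g_inj e.
  have [e|n13] := pselect (g _ D1 = g _ D3); first by apply: Or32; exact: g_inj e.
  apply: Or33; apply: (g_inj _ _ D2 D3).
  move: (g _ D1) (g _ D2) (g _ D3) (g2 _ D1) (g2 _ D2) (g2 _ D3) n12 n13.
  by lia.
- by apply: (well_founded_ind wf) => x IH; split=> y [_ /IH].
Qed.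

Theorem theorem5p63 (A : incidence) (X : Type)
    (A_plane : projective_plane A)
    (A_uncountable : ~ countable [set: elt A])
    (A_HF : exists lt : elt A -> elt A -> Prop, wellfounded_HF_order lt)
    (card_X : [set: X] #= [set: elt A]) :
  isomorphic A (free_completion (A0_union X)).
Proof.
have pg := projective_plane_graph A_plane.
have [lt /HF_orientation oD0] := A_HF.
have [l0 [p [q [r [B [C1 [C2 [sl0 tri]]]]]]]] := triangle_exists A_plane.
have [D [a [l [Y [oD sl basis [f f_inj fY]]]]]] :=
  five_point_basis_exists pg tri oD0 A_uncountable.
(* [Y] is a subset of the plane that contains an injective image of it, so it has the cardinality of
   [X]. *)
have [psi psi_inj psiY] : exists2 psi : X -> elt A, injective psi &
    range psi = Y.
  have /card_bijP[g [g' gK g'K]] : [set: X] #= Y.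
    apply: (card_eq_trans card_X); apply/card_eqPle; split; last exact: card_leT.
    apply: (@card_le_trans _ _ _ (range f)).
      by rewrite (card_le_eqr (inj_card_eq (in2W f_inj))).
    by apply: subset_card_le => _ [x _ <-].
  exists (fun x => set_val (g (to_setT x))) => [x y|].
    by move=> /val_inj /(can_inj gK) /(congr1 set_val).
  apply/seteqP; split=> [_ [x _ <-]|y Yy]; first exact: (set_valP (g _)).
  exists (set_val (g' (exist _ y (mem_set Yy)))) => //.
  rewrite (_ : to_setT _ = g' (exist _ y (mem_set Yy))); last exact: val_inj.
  by rewrite g'K.
have [a_inj sa aD lD YD cover] := basis.
have psiD x : only_out D (psi x) l by apply: YD; rewrite -psiY; exists x.
have {}sl : is_point l = false by rewrite sl; apply/negbTE.
have spsi x : is_point (psi x).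
  by have /(out_adj oD)/adjacent_sort -> : D (psi x) l by [apply/psiD]; rewrite sl.
have {}sa n : is_point (a n) by rewrite sa sl.
have psi_a n x : n < 5 -> psi x <> a n.
  by move=> n5 e; apply: (aD n l n5); rewrite -e; apply/psiD.
pose h (x : elt (A0_union X)) : elt A :=
  match x with
  | inl (inl i) => a i
  | inl (inr x) => psi x
  | inr tt => l
  end.
have h_sort x : is_point (h x) = is_point x.
  by case: x => [[i|x]|[]] /=; rewrite ?sl // ?sa ?spsi.
have adj_l p' : adjacent (h (inl p')) l <-> incident p' (tt : lines (A0_union X)).
  case: p' => [i|x] /=; last first.
    by split=> // _; apply: (out_adj oD); apply/psiD.
  split=> [/adjacent_sym /(adj_out oD)[/lD[]/a_inj ->//|/aD []//]|i2].
  apply/adjacent_sym/(out_adj oD)/lD.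
  by case: (nat_of_ord i) i2 => [|[|]] //; [left|right].
(* It remains to check that [h] is a free embedding; [cover] says that the elements outside its
   range have two arrows. *)
apply: (free_completion_iso pg oD (h0 := h)); split=> //.
- move=> [[i|x]|[]] [[j|y]|[]] //= e.
  + by congr (inl (inl _)); apply: val_inj; exact: a_inj.
  + by case: (psi_a _ _ (ltn_ord i) (esym e)).
  + by have := sa i; rewrite e sl.
  + by case: (psi_a _ _ (ltn_ord j) e).
  + by rewrite (psi_inj _ _ e).
  + by have := spsi x; rewrite e sl.
  + by have := sa j; rewrite -e sl.
  + by have := spsi y; rewrite -e sl.
- have same u v : is_point u = is_point v ->
      adjacent (h u) (h v) <-> adjacent u v.
    by move=> uv; split=> /adjacent_sort; rewrite ?h_sort uv; case: is_point.
  move=> [u|[]] [v|[]]; [exact: same|exact: adj_l| |exact: same].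
  split=> /adjacent_sym h2; apply: adjacent_sym; first by apply/adj_l.
  by move/adj_l: h2.
- move=> _ z [[[i|x]|[]] _ <-] /=.
  + by move=> /aD; case.
  + by move=> /psiD ->; exists (inr tt).
  + by move=> /lD[] ->; [exists (inl (inl ord0))|exists (inl (inl (inord 1)))];
      rewrite //= inordK.
- move=> x nx; case: (cover x) => // [[n n5 xa]|Yx]; case: nx.
    by exists (inl (inl (Ordinal n5))).
  by move: Yx; rewrite -psiY => -[y _ <-]; exists (inl (inr y)).
Qed.
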